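(* Let $c,D,r,\eta_\infty>0$, and let $u(\eta,\theta,\varphi)$, $\eta\in[0,\eta_\infty)$, be the solution of the random initial value problem described in the context, whose initial field $T$ is a centered isotropic Gaussian random field on $\mathbb{S}^2$ with angular power spectrum $\{C_l\}$. For $L\in\mathbb{N}$ let $$u_L(\eta,\theta,\varphi)=\sum_{l=0}^{L}F_l(\eta)\sum_{m=-l}^la_{lm}Y_{lm}(\theta,\varphi).$$ Then there is a constant $C>0$, not depending on $\eta$, such that for $L\in\mathbb{N}$ and $\eta\in[0,\eta_\infty)$ $$\big\|u(\eta,\theta,\varphi)-u_L(\eta,\theta,\varphi)\big\|_{L^2(\Omega\times\mathbb{S}^2)}\le C\left(\sum_{l=L+1}^\infty C_l(2l+1)\right)^{1/2}.$$
   Context: The initial value problem is: with $e(\eta)=\frac{\eta_\infty}{\eta_\infty-\eta}$, $$\left(\frac{e(\eta)}{D}+\frac{e'(\eta)}{c^2e(\eta)}\right)\frac{\partial u}{\partial\eta}+\frac1{c^2}\frac{\partial^2u}{\partial\eta^2}-\frac1{r^2}\frac{\partial^2u}{\partial\theta^2}-\frac1{r^2\sin^2\theta}\frac{\partial^2u}{\partial\varphi^2}-\frac{\cot\theta}{r^2}\frac{\partial u}{\partial\theta}=0,$$ $u|_{\eta=0}=T(\theta,\varphi)=\sum_{l=0}^\infty\sum_{m=-l}^la_{lm}Y_{lm}(\theta,\varphi)$, $\frac{\partial u}{\partial\eta}|_{\eta=0}=0$. Its solution is the series $u(\eta,\theta,\varphi)=\sum_{l=0}^\infty F_l(\eta)\sum_{m=-l}^la_{lm}Y_{lm}(\theta,\varphi)$,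 convergent in $L^2(\Omega\times\mathbb{S}^2)$. Functions $F_l$: $F_0(\eta)=1$ and, for $l\in\mathbb{N}$, $F_l(\eta)=(\eta_\infty-\eta)^\nu\big(K_1^{(l)}J_\nu(z_l(\eta_\infty-\eta))+K_2^{(l)}Y_\nu(z_l(\eta_\infty-\eta))\big)$, with $K_1^{(l)}=\frac{\pi z_lY_{\nu-1}(z_l\eta_\infty)}{2\eta_\infty^{\nu-1}}$, $K_2^{(l)}=-\frac{\pi z_lJ_{\nu-1}(z_l\eta_\infty)}{2\eta_\infty^{\nu-1}}$, $z_l=\frac{c\sqrt{l(l+1)}}{r}$, $\nu=\frac{c^2\eta_\infty}{2D}+1$; $J_\nu,Y_\nu$ (one index) are the Bessel functions of the first and second kind. $Y_{lm}$ (two indices) are the orthonormal spherical harmonics on the unit sphere $\mathbb{S}^2$ (with measure $\sin\theta\,d\theta\,d\varphi$). $T$ is real-valued, centered, Gaussian and isotropic (finite-dimensional distributions invariant under rotations); $a_{lm}$ are (complex) Gaussian variables with $a_{lm}=(-1)^ma_{l(-m)}^*$, $Ea_{lm}=0$, $Ea_{lm}a_{l'm'}^*=\delta_m^{m'}\delta_l^{l'}C_l$; $\{C_l\}$ is the angular power spectrum. Standing assumptions: $\sum_{l\ge0}C_l(2l+1)<\infty$; and $T$ is a.s. twice continuously differentiable in $(\theta,\varphi)$, or $\sum_{l\ge1}C_l\,l^{10}(2l+1)<\infty$. Norm: $\|X\|_{L^2(\Omega\times\mathbb{S}^2)}^2=E\int_0^\pi\int_0^{2\pi}X^2(\theta,\varphi)\sin\theta\,d\varphi\,d\theta$.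 *)

(* Defs.v *)
From HB Require Import structures.
From mathcomp Require Export all_boot all_order all_algebra.
From mathcomp Require Export all_classical all_reals all_analysis.
From mathcomp Require Export complex.

Set Implicit Arguments.
Unset Strict Implicit.
Unset Printing Implicit Defensive.

Import Order.TTheory GRing.Theory Num.Theory.
Import numFieldNormedType.Exports.

Local Open Scope classical_set_scope.
Local Open Scope ring_scope.
Local Open Scope complex_scope.

Section Bessel.
Context {R : realType}.
Implicit Types nu x : R.

(* 1 / Gamma(x), by Gauss's limit
   Gamma(x) = lim_n  n! n^x / (x (x + 1) ... (x + n)).
   The reciprocal is entire, with zeros at 0, -1, -2, ..., so no case
   distinction is needed. *)
Definition rgamma x : R :=
  limn (fun n : nat =>
    (\prod_(k < n.+1) (x + k%:R)) / (n`!%:R * n%:R `^ x)).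

(* Only meant for x > 0: real powers of x / 2 occur. *)
Definition besselJ nu x : R :=
  (x / 2) `^ nu *
  limn (series (fun k : nat =>
    (-1) ^+ k * rgamma (nu + k%:R + 1) / k`!%:R * (x / 2) ^+ (2 * k))).

Definition besselY_quot nu x : R :=
  (besselJ nu x * cos (nu * pi) - besselJ (- nu) x) / sin (nu * pi).

(* At integer orders the quotient is 0 / 0 and is replaced by its limiting
   value in the order. *)
Definition besselY nu x : R :=
  if nu \is a Num.int then lim (besselY_quot mu x @[mu --> nu^'])
  else besselY_quot nu x.

End Bessel.

Section SphericalHarmonics.
Context {R : realType}.

Definition legendre (l : nat) : {poly R} :=
  ((2 ^ l * l`!)%N%:R)^-1 *: (('X^2 - 1) ^+ l)^`(l).

Definition assoc_legendre (l m : nat) (x : R) : R :=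
  (-1) ^+ m * Num.sqrt (1 - x ^+ 2) ^+ m * ((legendre l)^`(m)).[x].

Definition sph_harm_nat (l m : nat) (theta phi : R) : R[i] :=
  (Num.sqrt ((2 * l + 1)%N%:R / (4 * pi) * ((l - m)`!%:R / (l + m)`!%:R))
     * assoc_legendre l m (cos theta))%:C
  * (cos (m%:R * phi) +i* sin (m%:R * phi)).

(* Orthonormal, Condon-Shortley phase; only meant for |m| <= l. *)
Definition sph_harm (l : nat) (m : int) (theta phi : R) : R[i] :=
  match m with
  | Posz n => sph_harm_nat l n theta phi
  | Negz n => (-1) ^+ n.+1 * conjc (sph_harm_nat l n.+1 theta phi)
  end.

(* The point of the unit sphere with colatitude theta and longitude phi. *)
Definition sph (theta phi : R) : 'rV[R]_3 :=
  \row_(j < 3) [:: sin theta * cos phi; sin theta * sin phi; cos theta]`_j.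

Definition on_sphere (x : 'rV[R]_3) : Prop := x *m x^T = 1%:M.

(* sum_(l <= L) f_l sum_(-l <= m <= l) a_lm Y_lm *)
Definition sph_partial_sum (f : nat -> R) (a : nat -> int -> R[i]) (L : nat)
    (theta phi : R) : R[i] :=
  \sum_(l < L.+1) (f l)%:C *
    \sum_(k < (2 * l).+1)
      a l (k%:Z - l%:Z) * sph_harm l (k%:Z - l%:Z) theta phi.

(* Twice continuously differentiable on the whole space. *)
Definition C2 {V : normedModType R} (f : V -> R) : Prop :=
  forall v w : V,
    [/\ forall x, derivable f x v, continuous ('D_v f),
        forall x, derivable ('D_v f) x w & continuous ('D_w ('D_v f))].

(* Laplace-Beltrami operator of the unit sphere in the coordinates
   (theta, phi); its (junk) value at sin theta = 0 is only used under integrals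
   over theta. *)
Definition sph_laplacian (f : R * R -> R) (x : R * R) : R :=
  'D_(1, 0) ('D_(1, 0) f) x
  + (sin x.1 ^+ 2)^-1 * 'D_(0, 1) ('D_(0, 1) f) x
  + cos x.1 / sin x.1 * 'D_(1, 0) f x.

End SphericalHarmonics.

Section RandomFields.
Context {R : realType} {d : measure_display} {Omega : measurableType d}.
Variable P : probability Omega R.
Local Notation mu := (@lebesgue_measure R).

(* Norm of L^2(Omega x S^2) for a (complex-valued) function of omega and of the
   angles; |X|^2 is X^2 when X is real. *)
Definition L2norm (X : Omega -> R -> R -> R[i]) : \bar R :=
  sqrte (\int[P]_w \int[mu]_(theta in `[0%R, pi%R])
    \int[mu]_(phi in `[0%R, (2 * pi)%R])
    ((complex.Re (X w theta phi) ^+ 2 + complex.Im (X w theta phi) ^+ 2)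
     * sin theta)%:E)%E.

Definition measurable_angles (X : Omega -> R -> R -> R) : Prop :=
  measurable_fun [set: Omega * (R * R)] (fun p => X p.1 p.2.1 p.2.2).

(* Normal law, degenerate laws included.  [normal_prob m 0] is not the Dirac
   mass, hence the case distinction. *)
Definition gaussian (X : Omega -> R) : Prop :=
  measurable_fun [set: Omega] X /\
  exists m s : R, 0 <= s /\
    forall A : set R, measurable A ->
      pushforward P X A = if s == 0 then \d_m A else normal_prob m s A.

Definition gaussian_field (T : 'rV[R]_3 -> Omega -> R) : Prop :=
  forall (n : nat) (x : 'I_n -> 'rV[R]_3) (b : 'I_n -> R),
    (forall i, on_sphere (x i)) ->
    gaussian (fun w => \sum_(i < n) b i * T (x i) w).

Definition centered_field (T : 'rV[R]_3 -> Omega -> R) : Prop :=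
  forall x, on_sphere x -> ('E_P[T x] = 0)%E.

(* g ranges over the rotations, acting on row vectors from the right. *)
Definition isotropic_field (T : 'rV[R]_3 -> Omega -> R) : Prop :=
  forall (g : 'M[R]_3) (n : nat) (x : 'I_n -> 'rV[R]_3),
    g *m g^T = 1%:M -> \det g = 1 -> (forall i, on_sphere (x i)) ->
    forall A : set (n.-tuple R), measurable A ->
      pushforward P (fun w => [tuple T (x i *m g) w | i < n]) A =
      pushforward P (fun w => [tuple T (x i) w | i < n]) A.

Definition complex_gaussian (Z : Omega -> R[i]) : Prop :=
  forall s t : R,
    gaussian (fun w => s * complex.Re (Z w) + t * complex.Im (Z w)).

Definition has_mean (Z : Omega -> R[i]) (z : R[i]) : Prop :=
  [/\ P.-integrable [set: Omega] (fun w => (complex.Re (Z w))%:E),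
      P.-integrable [set: Omega] (fun w => (complex.Im (Z w))%:E),
      ('E_P[fun w => complex.Re (Z w)] = (complex.Re z)%:E)%E &
      ('E_P[fun w => complex.Im (Z w)] = (complex.Im z)%:E)%E].

Definition spectral_coefs (a : nat -> int -> Omega -> R[i]) (Cl : nat -> R) :
    Prop :=
  [/\ forall l (m : int), (`|m| <= l)%N -> complex_gaussian (a l m),
      forall l (m : int), (`|m| <= l)%N ->
        {ae P, forall w, a l m w = (-1) ^+ `|m|%N * conjc (a l (- m) w)},
      forall l (m : int), (`|m| <= l)%N -> has_mean (a l m) 0 &
      forall l l' (m m' : int), (`|m| <= l)%N -> (`|m'| <= l')%N ->
        has_mean (fun w => a l m w * conjc (a l' m' w))
          (if (l == l') && (m == m') then (Cl l)%:C else 0)].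

End RandomFields.

Section InitialValueProblem.
Context {R : realType}.
Variables c D r eta_oo : R.

Definition escale (eta : R) : R := eta_oo / (eta_oo - eta).

Definition nu_index : R := c ^+ 2 * eta_oo / (2 * D) + 1.

Definition z_freq (l : nat) : R := c * Num.sqrt (l * l.+1)%N%:R / r.

Definition K1_coef (l : nat) : R :=
  pi * z_freq l * besselY (nu_index - 1) (z_freq l * eta_oo)
  / (2 * eta_oo `^ (nu_index - 1)).

Definition K2_coef (l : nat) : R :=
  - (pi * z_freq l * besselJ (nu_index - 1) (z_freq l * eta_oo)
     / (2 * eta_oo `^ (nu_index - 1))).

Definition F_mode (l : nat) (eta : R) : R :=
  if l is 0 then 1 else
  (eta_oo - eta) `^ nu_index *
  (K1_coef l * besselJ nu_index (z_freq l * (eta_oo - eta)) +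
   K2_coef l * besselY nu_index (z_freq l * (eta_oo - eta))).

Context {d : measure_display} {Omega : measurableType d}.

Definition u_trunc (a : nat -> int -> Omega -> R[i]) (L : nat) (eta : R)
    (w : Omega) (theta phi : R) : R[i] :=
  sph_partial_sum (fun l => F_mode l eta) (fun l m => a l m w) L theta phi.

Variable P : probability Omega R.
Local Notation mu := (@lebesgue_measure R).

(* E int_(S^2) X xi f, with xi a random variable and f a function of the angles. *)
Definition pairing (X : Omega -> R -> R -> R) (xi : Omega -> R)
    (f : R * R -> R) : R :=
  (\int[P]_w \int[mu]_(theta in `[0, pi]) \int[mu]_(phi in `[0, 2 * pi])
    (X w theta phi * xi w * f (theta, phi) * sin theta))%R.

(* The initial value problem in L^2(Omega x S^2): the equation, divided into its
   eta-part and its angular part, is tested against xi (x) g, with xi in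
   L^2(Omega) and g in C^2(S^2) (the restriction to the sphere of a C^2 function
   on R^3), the (self-adjoint) angular part being moved to g. *)
Definition ivp_solution (T : 'rV[R]_3 -> Omega -> R)
    (u : R -> Omega -> R -> R -> R) : Prop :=
  [/\ forall eta : R, 0 <= eta < eta_oo -> measurable_angles (u eta),
      forall eta : R, 0 <= eta < eta_oo ->
        (L2norm P (fun w theta phi => (u eta w theta phi)%:C) < +oo)%E,
      forall (xi : Omega -> R) (g : 'rV[R]_3 -> R),
        measurable_fun [set: Omega] xi ->
        P.-integrable [set: Omega] (fun w => (xi w ^+ 2)%:E) ->
        C2 g ->
        let f : R * R -> R := fun x => g (sph x.1 x.2) in
        let h : R -> R := fun eta => pairing (u eta) xi f in
        (forall eta : R, 0 < eta < eta_oo ->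
          [/\ derivable h eta 1, derivable (derive1 h) eta 1 &
              (escale eta / D + derive1 escale eta / (c ^+ 2 * escale eta))
                * derive1 h eta
              + (c ^+ 2)^-1 * derive1 (derive1 h) eta
              - (r ^+ 2)^-1 * pairing (u eta) xi (sph_laplacian f) = 0]) /\
        eta^-1 * (h eta - h 0) @[eta --> 0^'+] --> (0 : R) &
      L2norm P (fun w theta phi =>
         (u 0 w theta phi - T (sph theta phi) w)%:C) = 0%E].

End InitialValueProblem.

(* Main.v *)
(** The special functions never have to be analysed.  Testing the equation
    against Re a_l0 and the zonal harmonic Y_l0 turns it into an ordinary
    differential equation for h = C_l F_l, namely
      q h' + h'' / c^2 + l (l + 1) / r^2 h = 0,   q >= 0,
    with h (0) = C_l and h' (0) = 0.  The energy
    h'^2 / c^2 + l (l + 1) / r^2 h^2 does not increase, so |F_l| <= 1 as soon as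
    C_l <> 0; the modes with C_l = 0 do not contribute to the norm.  Since the
    coefficients a_lm are uncorrelated and the Y_lm are normalised,
      || u_N - u_L ||^2 = sum_(L < l <= N) F_l^2 C_l (2 l + 1),
    and the bound follows, with constant 1, by letting N tend to infinity. *)

From HB Require Import structures.
Require Import Defs.
From mathcomp Require Import measurable_realfun ring lra zify.

Set Implicit Arguments.
Unset Strict Implicit.
Unset Printing Implicit Defensive.

Import Order.TTheory GRing.Theory Num.Theory.
Import numFieldNormedType.Exports.

Local Open Scope classical_set_scope.
Local Open Scope ring_scope.
Local Open Scope complex_scope.

(** * Norms of the associated Legendre polynomials *)

Section PolynomialIntegral.
Context {R : realType}.
Implicit Types p q : {poly R}.

(** The order m = 0 is the convenient one: F_l does not depend on m, a_l0 is almost surely real, and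
    Y_l0 is a polynomial in the third coordinate, hence an admissible C^2 test function. Mean square
    convergence of the series and Cauchy-Schwarz identify the pairing with C_l F_l, while h (0) =
    C_l is read off the expansion of T. The delicate point of the energy argument is the end 0: h is
    known to be differentiable on the open interval only, and the condition at 0 concerns a
    one-sided difference quotient, so the energy near 0 is reached through mean value points.
    Iterated integrals are moved to the product measure with the square root of the surface density
    attached to each factor, so that a single Cauchy-Schwarz inequality serves Omega and the angles
    at once. The constant 1 survives the limit in N thanks to (x + y)^2 <= (1 + t) y^2 + (1 + 1/t)
    x^2 with t small. *)

Definition antideriv p : {poly R} := \poly_(i < (size p).+1) (p`_i.-1 / i%:R).

Lemma deriv_antideriv p : (antideriv p)^`() = p.
Proof.
apply/polyP => i; rewrite coef_deriv coef_poly ltnS.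
case: ltnP => [_|/leq_sizeP ->//]; last by rewrite mul0rn.
by rewrite -[LHS]mulr_natr divfK// pnatr_eq0.
Qed.

Lemma deriv_eq0 p : p^`() = 0 -> p = (p`_0)%:P.
Proof.
move=> p'0; apply/polyP => -[|i]; rewrite coefC//=.
have := congr1 (fun q : {poly R} => q`_i) p'0.
by rewrite coef_deriv coef0 => /eqP; rewrite mulrn_eq0 /= => /eqP.
Qed.

(* The integral of [p] over [-1, 1]. *)
Definition polyint p : R := (antideriv p).[1] - (antideriv p).[-1].

(** Every polynomial is the derivative of its [antideriv], so linearity and integration by parts for
    [polyint] all reduce to boundary values. *)
Lemma polyint_deriv q : polyint q^`() = q.[1] - q.[-1].
Proof.
have /deriv_eq0 : (antideriv q^`() - q)^`() = 0.
  by rewrite derivB deriv_antideriv subrr.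
move=> /eqP; rewrite subr_eq /polyint => /eqP ->.
rewrite !hornerD !hornerC. by rewrite opprD addrACA subrr add0r.
Qed.

Lemma polyintD p q : polyint (p + q) = polyint p + polyint q.
Proof.
rewrite -{1}(deriv_antideriv p) -{1}(deriv_antideriv q) -derivD polyint_deriv.
by rewrite !hornerD opprD addrACA.
Qed.

Lemma polyintZ a p : polyint (a *: p) = a * polyint p.
Proof.
rewrite -{1}(deriv_antideriv p) -derivZ polyint_deriv.
by rewrite !hornerZ -mulrBr.
Qed.

Lemma polyintN p : polyint (- p) = - polyint p.
Proof. by rewrite -scaleN1r polyintZ mulN1r. Qed.

Lemma polyint_by_parts p q : p.[1] * q.[1] = 0 -> p.[-1] * q.[-1] = 0 ->
  polyint (p * q^`()) = - polyint (p^`() * q).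
Proof.
move=> h1 hN1; apply/eqP; rewrite -subr_eq0 opprK -polyintD addrC -derivM.
by rewrite polyint_deriv !hornerM h1 hN1 subrr.
Qed.

(** Each derivative costs at most one factor [p]. For [p] = X^2 - 1 and i < n this is the vanishing
    at 1 and -1 that removes boundary terms. *)
Lemma derivn_expM_factor (p q : {poly R}) n i : (i <= n)%N ->
  exists q' : {poly R}, (p ^+ n * q)^`(i) = p ^+ (n - i) * q'.
Proof.
elim: i => [_|i IHi ltin]; first by exists q; rewrite subn0.
have [q' e] := IHi (ltnW ltin).
rewrite derivnS e -(subnSK ltin) derivM deriv_exp /=.
move: (n - i.+1)%N => k; exists (p^`() *+ k.+1 * q' + p * q'^`()).
by rewrite exprS; ring.
Qed.

(** The integral I_n of (1 - x^2)^n is 2 (2^n n!)^2 / (2n + 1)!, here cleared of denominators with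
    (2n + 1)! split. The induction rests on (2n + 3) I_(n+1) = (2n + 2) I_n. *)
Lemma polyint_1subX2_exp n :
  (2 * n)`!%:R * (polyint ((1 - 'X^2) ^+ n) * (2 * n + 1)%N%:R)
  = 2 * (2 ^ n * n`!)%N%:R ^+ 2 :> R.
Proof.
elim: n => [|n IHn].
  have -> : polyint ((1 - 'X^2) ^+ 0) = 2 :> R.
    by rewrite expr0 -(derivX R) polyint_deriv !hornerX; ring.
  by rewrite muln0 expn0 fact0; ring.
have bnd (x : R) : x ^+ 2 = 1 -> ('X * (1 - 'X^2) ^+ n.+1).[x] = 0.
  by move=> x1; rewrite hornerM horner_exp !hornerE x1 subrr expr0n mulr0.
have derivX2 : (1 - 'X^2 : {poly R})^`() = - ('X *+ 2).
  by rewrite derivB derivXn -polyC1 derivC sub0r.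
have rec : (2 * n%:R + 3) * polyint ((1 - 'X^2) ^+ n.+1) =
    (2 * n%:R + 2) * polyint ((1 - 'X^2) ^+ n) :> R.
  apply/eqP; rewrite -subr_eq0 -!polyintZ -polyintN -polyintD.
  (* The recurrence expresses that this derivative integrates to zero, as X (1 - X^2)^(n+1) vanishes
     at both ends. *)
  rewrite (_ : _ + _ = ('X * (1 - 'X^2) ^+ n.+1)^`()).
    by rewrite polyint_deriv !bnd ?subrr ?sqrrN ?expr1n.
  rewrite derivM deriv_exp derivX2 derivX -!mul_polyC -[_ *+ n.+1]mulr_natr
    -[n.+1%:R]natr1.
  by rewrite !(polyCM, polyCD) !polyC_natr [(1 - 'X^2) ^+ n.+1]exprS; ring.
have -> : (2 * n.+1 = (2 * n).+2)%N by rewrite mulnS.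
have -> : ((2 * n).+2 + 1 = (2 * n).+3)%N by rewrite addn1.
move: rec IHn; rewrite addn1 expnS !factS !natrM -![(2 * n).+1%:R]natr1.
rewrite -[(2 * n).+3%:R]natr1 -[(2 * n).+2%:R]natr1 -[(2 * n).+1%:R]natr1.
rewrite -[n.+1%:R]natr1 !natrM.
set B' := polyint _; set B := polyint _; set f := _`!%:R.
move=> rec IHn.
transitivity ((2 * n%:R + 2) * (2 * n%:R + 1) * f * ((2 * n%:R + 3) * B')).
  by ring.
rewrite rec.
transitivity ((2 * n%:R + 2) ^+ 2 * (f * (B * (2 * n%:R + 1)))); first by ring.
by rewrite IHn; ring.
Qed.

End PolynomialIntegral.


Section LegendreNorm.
Context {R : realType}.
Variable l : nat.
Local Notation w := (('X^2 - 1) ^+ l : {poly R}).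
Local Notation P m := ((legendre l : {poly R})^`(m)).

Lemma deriv_rodrigues : ('X^2 - 1) * w^`() = (2 * l%:R)%:P * 'X * w.
Proof.
case: l => [|k]; first by rewrite !expr0 -polyC1 derivC !(mulr0, mul0r).
rewrite deriv_exp /= derivB derivXn -polyC1 derivC subr0 /= expr1.
rewrite polyCM polyC_natr -[k.+1]/(1 + k)%N exprD; ring.
Qed.

(** Obtained by differentiating [deriv_rodrigues] n + 1 times, one derivative per induction step. *)
Lemma derivn_rodrigues n :
  ('X^2 - 1) * w^`(n.+2) =
  (2 * (l%:R - n%:R - 1))%:P * 'X * w^`(n.+1)
  + ((n%:R + 1) * (2 * l%:R - n%:R))%:P * w^`(n).
Proof.
have derivX2 : ('X^2 - 1 : {poly R})^`() = 'X *+ 2.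
  by rewrite derivB derivXn -polyC1 derivC subr0.
elim: n => [|n IHn].
  have /(congr1 deriv) := deriv_rodrigues.
  rewrite !derivM derivX2 derivC derivX [w^`(0)]/= [w^`(1)]/= [w^`(2)]/=.
  set w1 := w^`(); set w2 := w1^`(); set q := 'X^2 - 1 => h.
  have -> : q * w2 = 'X *+ 2 * w1 + q * w2 - 'X *+ 2 * w1 by ring.
  by rewrite h; ring.
move: IHn => /(congr1 deriv); rewrite derivD !derivM derivX2 !derivC derivX.
rewrite -!derivnS -[n.+1%:R]natr1.
set q := 'X^2 - 1; set w3 := w^`(n.+3); set w2 := w^`(n.+2) => h.
have -> : q * w3 = 'X *+ 2 * w2 + q * w3 - 'X *+ 2 * w2 by ring.
by rewrite h; ring.
Qed.

Lemma legendre_derivn m :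
  P m = ((2 ^ l * l`!)%N%:R)^-1 *: w^`(l + m).
Proof. by rewrite /legendre derivnZ /derivn addnC iterD. Qed.

(** The case n = l + m of [derivn_rodrigues]. At m = 0 it is Legendre's equation, which later yields
    the eigenvalue of the zonal harmonics. *)
Lemma legendre_ode m :
  ('X^2 - 1) * P m.+2 + (2 * (m%:R + 1))%:P * 'X * P m.+1 =
  ((l%:R - m%:R) * (l%:R + m%:R + 1))%:P * P m.
Proof.
rewrite !legendre_derivn !addnS -!scalerAr derivn_rodrigues -scalerDr.
by congr (_ *: _); rewrite natrD; ring.
Qed.

(** Sturm-Liouville form of [legendre_ode], after multiplication by (1 - X^2)^m, ready for
    integration by parts. *)
Lemma legendre_assoc_ode m :
  ((1 - 'X^2) ^+ m.+1 * P m.+1)^`() =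
  - ((l%:R - m%:R) * (l%:R + m%:R + 1)) *: ((1 - 'X^2) ^+ m * P m).
Proof.
rewrite -mul_polyC polyCN mulNr mulrCA -legendre_ode.
have derivX2 : (1 - 'X^2 : {poly R})^`() = - ('X *+ 2).
  by rewrite derivB derivXn -polyC1 derivC sub0r.
rewrite derivM deriv_exp derivX2 -derivnS /=.
set q0 := legendre l; set q1 := (q0^`(m))^`(); set q2 := q1^`().
rewrite -mulr_natr -[m.+1%:R]natr1 !(polyCM, polyCD) !polyC_natr.
by rewrite [(1 - 'X^2) ^+ m.+1]exprS; ring.
Qed.

(** Squaring turns the factor sqrt(1 - x^2)^m of the associated Legendre function into (1 - x^2)^m,
    so its squared norm is the integral of a polynomial. *)
Definition legendre_sqnorm m : R := polyint ((1 - 'X^2) ^+ m * P m ^+ 2).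

(** One factor P^(m+1) is integrated by parts; the weight (1 - X^2)^(m+1) removes the boundary
    terms. *)
Lemma legendre_sqnormS m : legendre_sqnorm m.+1 =
  (l%:R - m%:R) * (l%:R + m%:R + 1) * legendre_sqnorm m.
Proof.
rewrite {1}/legendre_sqnorm [P m.+1 ^+ 2]expr2 mulrA [X in polyint
  (_ * X)]derivnS.
have bnd (x : R) (q : {poly R}) y :
    x ^+ 2 = 1 -> ((1 - 'X^2) ^+ m.+1 * q).[x] * y = 0.
  by move=> x1; rewrite hornerM horner_exp !hornerE x1 subrr expr0n !mul0r.
rewrite polyint_by_parts ?bnd ?sqrrN ?expr1n//.
rewrite legendre_assoc_ode -scalerAl polyintZ mulNr opprK.
by rewrite /legendre_sqnorm [P m ^+ 2]expr2 mulrA.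
Qed.

Lemma derivn_2l_rodrigues : w^`(2 * l) = (2 * l)`!%:R%:P.
Proof.
have m1 : 'X^2 - 1 \is @monic R by rewrite -polyC1 monicXnsubC.
have sw : size w = (2 * l).+1.
  rewrite -[LHS]prednK ?size_exp ?size_XnsubC// lt0n size_poly_eq0.
  by rewrite expf_neq0// monic_neq0.
apply/polyP => i; rewrite coef_derivn coefC; case: i => [|i] /=.
  rewrite addn0 ffactnn; have /monicP := monic_exp l m1.
  by rewrite lead_coefE sw /= => ->.
by rewrite nth_default ?mul0rn// sw addnS ltnS leq_addr.
Qed.

(** Integrations by parts move j derivatives from one factor to the other; a factor differentiated
    fewer than l times still contains X^2 - 1. *)
Lemma polyint_rodrigues_parts j : (j <= l)%N ->
  polyint (w^`(l) * w^`(l)) = (-1) ^+ j * polyint (w^`(l + j) * w^`(l - j)).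
Proof.
elim: j => [_|j IHj jl]; first by rewrite addn0 subn0 mul1r.
have bnd (x : R) : x ^+ 2 = 1 -> w^`(l - j.+1).[x] = 0.
  have [q] := derivn_expM_factor ('X^2 - 1 : {poly R}) 1 (leq_subr j.+1 l).
  by rewrite mulr1 => -> x1; rewrite hornerM horner_exp !hornerE x1 subrr
    subKn// expr0n mul0r.
rewrite IHj 1?ltnW// -(subnSK jl) derivnS mulrC.
rewrite polyint_by_parts ?bnd ?sqrrN ?expr1n ?mulr0//.
by rewrite [(-1) ^+ j.+1]exprSr addnS derivnS -!mulrA mulN1r mulrC.
Qed.

(** Once all derivatives sit on one factor (j = l), the integrand is (2l)! w, and (-1)^l w = (1 -
    X^2)^l. *)
Lemma legendre_sqnorm0 : legendre_sqnorm 0 = 2 / (2 * l + 1)%N%:R.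
Proof.
rewrite /legendre_sqnorm mul1r derivn0 /legendre exprZn polyintZ expr2.
rewrite (polyint_rodrigues_parts (leqnn l)) subnn derivn0 addnn -mul2n.
rewrite derivn_2l_rodrigues mul_polyC polyintZ.
rewrite [(-1) ^+ l * _]mulrCA -[(-1) ^+ l * _]polyintZ -exprZn.
rewrite scaleN1r opprB.
have := @polyint_1subX2_exp R l; set B := polyint _ => hB.
rewrite natrM in hB *; set k := (_ * l`!%:R) in hB *.
have k0 : k != 0 by rewrite /k -natrM pnatr_eq0 -lt0n muln_gt0 expn_gt0 fact_gt0.
have d0 : (2 * l + 1)%:R != 0 :> R by rewrite addn1.
by apply: (mulIf d0); rewrite divfK// -!mulrA hB; field.
Qed.

Lemma legendre_sqnormE m : (m <= l)%N -> legendre_sqnorm m =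
  2 / (2 * l + 1)%N%:R * ((l + m)`!%:R / (l - m)`!%:R).
Proof.
elim: m => [_|m IHm ml].
  by rewrite legendre_sqnorm0 addn0 subn0 divff ?mulr1// pnatr_eq0 -lt0n fact_gt0.
rewrite legendre_sqnormS IHm 1?ltnW// [(l + m.+1)%N]addnS factS -(subnSK ml)
  factS !natrM.
have lm0 : l%:R - m%:R != 0 :> R by rewrite subr_eq0 eqr_nat gtn_eqF.
have f0 : (l - m.+1)`!%:R != 0 :> R by rewrite pnatr_eq0 -lt0n fact_gt0.
rewrite (subnSK ml) natrB; last exact: ltnW.
have -> : (l + m).+1%:R = l%:R + m%:R + 1 :> R by rewrite -natr1 natrD.
have d0 : (2 * l + 1)%:R != 0 :> R by rewrite addn1.
move: lm0 f0 d0; set s := _ - _; set t := (l - m.+1)`!%:R.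
set t' := (l + m)`!%:R; set v := (2 * l + 1)%:R.
move: s t t' v => s t t' v s0 t0 v0.
by field; rewrite v0 t0 s0.
Qed.

End LegendreNorm.

(** * Integrals over product spaces *)

Section ProductMeasure.
Context {d1 d2 : measure_display} {T1 : measurableType d1}
  {T2 : measurableType d2} {R : realType}.
Variables (m1 : {sigma_finite_measure set T1 -> \bar R})
  (m2 : {sigma_finite_measure set T2 -> \bar R}).

(* The canonical sigma-finite structure of [m1 \x m2] is only found when both
   factors are probabilities; an alias makes it available in general. *)
Definition prod_measure : set (T1 * T2) -> \bar R := (m1 \x m2)%E.

HB.instance Definition _ := Measure.copy prod_measure (m1 \x m2)%E.

Let sigma_finite_prod_measure : sigma_finite [set: T1 * T2] prod_measure.
Proof.
have /sigma_finiteP[F [TF ndF Foo]] := sigma_finiteT m1.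
have /sigma_finiteP[G [TG ndG Goo]] := sigma_finiteT m2.
exists (fun n => F n `*` G n) => [|k].
  apply/seteqP; split=> // -[x y] _.
  have [[n _ Fx] [k _ Gy]] : (\bigcup_n F n) x /\ (\bigcup_n G n) y.
    by rewrite -TF -TG.
  exists (maxn n k) => //; split => /=.
    by move: x Fx; exact/subsetPset/ndF/leq_maxl.
  by move: y Gy; exact/subsetPset/ndG/leq_maxr.
have [mF F_lty] := Foo k; have [mG G_lty] := Goo k.
split; first exact: measurableX.
by rewrite [ltLHS]product_measure1E// lte_mul_pinfty// ge0_fin_numE.
Qed.

HB.instance Definition _ :=
  Measure_isSigmaFinite.Build _ _ _ prod_measure sigma_finite_prod_measure.

End ProductMeasure.

Section IteratedIntegrals.
Context {d1 d2 : measure_display} {T1 : measurableType d1}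
  {T2 : measurableType d2} {R : realType}.
Variables (m1 : {sigma_finite_measure set T1 -> \bar R})
  (m2 : {sigma_finite_measure set T2 -> \bar R}).

Lemma prod_measure_tonelli (f : T1 * T2 -> \bar R) :
  measurable_fun setT f -> (forall x, 0 <= f x)%E ->
  (\int[prod_measure m1 m2]_x f x = \int[m1]_x \int[m2]_y f (x, y))%E.
Proof. by move=> mf f0; exact: fubini_tonelli1. Qed.

(** The inner integral may fail to be finite on a null set of x, where [fine] gives 0; this affects
    neither integrability nor the value. *)
Lemma prod_measure_fubini (f : T1 * T2 -> R) :
  (prod_measure m1 m2).-integrable setT (EFin \o f) ->
  m1.-integrable setT (EFin \o (fun x => \int[m2]_y f (x, y)))%R /\
  (\int[prod_measure m1 m2]_x f x = \int[m1]_x \int[m2]_y f (x, y))%R.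
Proof.
move=> intf.
have iF := @integrable_fubini_F _ _ _ _ _ m1 m2 _ intf.
have mF : measurable_fun setT (EFin \o (fun x => \int[m2]_y f (x, y)))%R.
  apply/measurable_EFinP; apply: measurableT_comp => //.
  exact: measurable_int iF.
split.
  apply: le_integrable iF => // x _ /=.
  by rewrite /Rintegral /fubini_F /=; case: (integral _ _ _) => [r||] //=;
    rewrite ?normr0 leey.
rewrite /Rintegral -(integral12_prod_meas1 intf); congr fine.
apply: ae_eq_integral => //; first exact: measurable_int iF.
have := @ae_integrable1 _ _ _ _ _ m1 m2 _ intf.
apply: filterS => x ifx _.
by rewrite /Rintegral fineK//; exact: integrable_fin_num ifx.
Qed.

End IteratedIntegrals.

(** * Integrability together with the value of the integral; Cauchy-Schwarz *)

Section HasIntegral.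
Context {d : measure_display} {T : measurableType d} {R : realType}.
Variable mu : {measure set T -> \bar R}.
Implicit Types (f g : T -> R) (a b : R).

(** Bundling integrability with the value lets each linear manipulation establish both at once. *)
Definition has_int f a : Prop :=
  mu.-integrable setT (EFin \o f) /\ (\int[mu]_x (f x)%:E)%E = a%:E.

Lemma has_int_Rintegral f :
  mu.-integrable setT (EFin \o f) -> has_int f (\int[mu]_x f x)%R.
Proof. by move=> fi; split=> //; rewrite fineK//; exact: integrable_fin_num. Qed.

Lemma Rintegral_has_int f a : has_int f a -> (\int[mu]_x f x)%R = a.
Proof. by case=> _; rewrite /Rintegral => ->. Qed.

Lemma eq_has_int f g a : f =1 g -> has_int f a -> has_int g a.
Proof. by move=> /funext ->. Qed.

Lemma has_intD f g a b : has_int f a -> has_int g b ->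
  has_int (fun x => f x + g x) (a + b).
Proof.
move=> [fi fa] [gi gb]; split.
  by have := integrableD measurableT fi gi; apply: eq_integrable => // x _.
by under eq_integral do rewrite EFinD; rewrite integralD// fa gb.
Qed.

Lemma has_intZ k f a : has_int f a -> has_int (fun x => k * f x) (k * a).
Proof.
move=> [fi fa]; split.
  by have := integrableZl measurableT k fi; apply: eq_integrable => // x _.
by under eq_integral do rewrite EFinM; rewrite integralZl// fa.
Qed.

Lemma has_intB f g a b : has_int f a -> has_int g b ->
  has_int (fun x => f x - g x) (a - b).
Proof.
move=> fa /(has_intZ (-1)) gb; rewrite -mulN1r.
by apply: eq_has_int (has_intD fa gb) => x /=; rewrite mulN1r.
Qed.

Lemma has_int0 : has_int (fun=> 0) 0.
Proof. by split; [exact: integrable0 | rewrite integral0]. Qed.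

Lemma has_int_sum (I : eqType) (s : seq I) (F : I -> T -> R) (v : I -> R) :
  (forall i, i \in s -> has_int (F i) (v i)) ->
  has_int (fun x => \sum_(i <- s) F i x) (\sum_(i <- s) v i).
Proof.
elim: s => [_|i s IHs h].
  by rewrite big_nil; apply: eq_has_int has_int0 => x; rewrite big_nil.
rewrite big_cons; apply: eq_has_int
  (fun x => F i x + \sum_(j <- s) F j x) _ _ _ _.
  by move=> x; rewrite big_cons.
apply: has_intD; first by apply: h; rewrite mem_head.
by apply: IHs => j js; apply: h; rewrite in_cons js orbT.
Qed.

Lemma has_int_uniq f a b : has_int f a -> has_int f b -> a = b.
Proof. by move=> /Rintegral_has_int <- /Rintegral_has_int <-. Qed.

Lemma has_int_ge0 f a : (forall x, 0 <= f x) -> has_int f a -> 0 <= a.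
Proof.
move=> f0 [_ fa]; rewrite -lee_fin -fa.
by apply: integral_ge0 => x _; rewrite lee_fin.
Qed.

Lemma has_int_nonneg f : measurable_fun setT f -> (forall x, 0 <= f x) ->
  (\int[mu]_x (f x)%:E < +oo)%E -> exists a, has_int f a.
Proof.
move=> mf f0 fy; exists (fine (\int[mu]_x (f x)%:E)); apply: has_int_Rintegral.
apply/integrableP; split; first exact/measurable_EFinP.
by under eq_integral => x _ do rewrite /= ger0_norm//.
Qed.

(** Serves to discard Im a_l0, which vanishes only almost surely. *)
Lemma ae_has_int f g a : measurable_fun setT g ->
  {ae mu, forall x, f x = g x} -> has_int f a -> has_int g a.
Proof.
move=> mg fg [fi fa].
have fg' : ae_eq mu setT (EFin \o f) (EFin \o g).
  by apply: filterS fg => x /= -> _.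
have mf : measurable_fun setT (EFin \o f) by exact: measurable_int fi.
split.
  apply/integrableP; split; first exact/measurable_EFinP.
  have <- : (\int[mu]_x `|(f x)%:E| = \int[mu]_x `|(g x)%:E|)%E.
    apply: ae_eq_integral => //.
    - exact: measurableT_comp.
    - by apply: measurableT_comp => //; exact/measurable_EFinP.
    - by apply: filterS fg => x -> _.
  by move/integrableP: fi => [].
by rewrite -fa; apply/esym/ae_eq_integral => //; exact/measurable_EFinP.
Qed.

(** Cauchy-Schwarz, with the integrability of the product as part of the conclusion. *)
Lemma has_int_mul f g a b :
  measurable_fun setT f -> measurable_fun setT g ->
  has_int (fun x => f x ^+ 2) a -> has_int (fun x => g x ^+ 2) b ->
  exists2 v, has_int (fun x => f x * g x) v & v ^+ 2 <= a * b.
Proof.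
move=> mf mg fa gb.
have [/has_int_Rintegral fgv] : mu.-integrable setT (EFin \o
  (fun x => f x * g x)).
  have [i2 _] := has_intD fa gb.
  (* Dominated by f^2 + g^2. *)
  apply: le_integrable i2 => //; first by apply/measurable_EFinP/measurable_funM.
  move=> x _; rewrite /= lee_fin [leRHS]ger0_norm ?addr_ge0 ?sqr_ge0//.
  by rewrite ler_norml; apply/andP; split; nra.
set v := Rintegral _ _ _ in fgv; exists v => //.
have quad t : 0 <= t ^+ 2 * a + 2 * t * v + b.
  apply: (@has_int_ge0 (fun x => (t * f x + g x) ^+ 2)).
    by move=> x; exact: sqr_ge0.
  apply: eq_has_int (has_intD (has_intD (has_intZ (t ^+ 2) fa) (has_intZ
    (2 * t) fgv)) gb).
  by move=> x /=; ring.
have a0 : 0 <= a by apply: has_int_ge0 fa => x; exact: sqr_ge0.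
have [a00|an0] := eqVneq a 0.
  have [->|v0] := eqVneq v 0; first by rewrite a00 expr0n mul0r.
  (* For a = 0 the quadratic is affine in t; this t gives it the value -1. *)
  have := quad (- (b + 1) / (2 * v)); rewrite a00.
  have -> : (- (b + 1) / (2 * v)) ^+ 2 * 0 + 2 * (- (b + 1) /
    (2 * v)) * v + b = -1.
    by field.
  lra.
(* The minimiser of the quadratic, where its value is (a b - v^2) / a. *)
have := quad (- v / a).
have -> : (- v / a) ^+ 2 * a + 2 * (- v / a) * v + b = (a * b - v ^+ 2) / a.
  by field.
by rewrite pmulr_lge0 ?subr_ge0// invr_gt0 lt_neqAle eq_sym an0.
Qed.

End HasIntegral.

(** * Integration over the sphere *)

Section SphereIntegrals.
Context {R : realType}.
Local Notation mu := (@lebesgue_measure R).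

(* Square root of the density of the surface measure ([sin] is nonnegative on
   [[0, pi]]): the weight is shared between the two factors of an inner
   product. *)
Definition half_density (theta phi : R) : R :=
  \1_(`[0, pi]%classic : set R) theta * \1_(`[0, 2 * pi]%classic : set R) phi
  * Num.sqrt (sin theta).

Lemma half_density_sqr theta phi : half_density theta phi ^+ 2 =
  \1_(`[0, pi]%classic : set R) theta * \1_(`[0, 2 * pi]%classic : set R) phi
  * sin theta.
Proof.
rewrite /half_density !indicE !exprMn.
have [th|_] := boolP (theta \in _); last by rewrite expr0n !mul0r.
rewrite sqr_sqrtr; last by apply: sin_ge0_pi; move: th; rewrite inE.
by case: (phi \in _); rewrite /= ?expr1n ?expr0n.
Qed.

Lemma integral_half_density (f : R -> R -> R) :
  (\int[mu]_(theta in `[0%R, pi%R]) \int[mu]_(phi in `[0%R, (2 * pi)%R])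
    (f theta phi * sin theta)%:E)%E =
  (\int[mu]_theta \int[mu]_phi (f theta phi * half_density theta phi ^+ 2)%:E)%E.
Proof.
rewrite integral_mkcond; apply: eq_integral => theta _.
rewrite patchE; case: ifPn => th; last first.
  rewrite integral0_eq// => phi _.
  by rewrite half_density_sqr indicE (negbTE th) !mul0r mulr0.
rewrite integral_mkcond; apply: eq_integral => phi _.
rewrite patchE half_density_sqr !indicE th mul1r.
by case: ifPn => _; rewrite ?mul1r// !mul0r mulr0.
Qed.

Lemma Rintegral_half_density (f : R -> R -> R) :
  (\int[mu]_(theta in `[0, pi]) \int[mu]_(phi in `[0, 2 * pi])
    (f theta phi * sin theta))%R =
  (\int[mu]_theta \int[mu]_phi (f theta phi * half_density theta phi ^+ 2))%R.
Proof.
rewrite Rintegral_mkcond; apply: eq_Rintegral => theta _.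
rewrite patchE; case: ifPn => th; last first.
  rewrite [RHS](_ : _ = (\int[mu]_(phi in setT) 0)%R).
    by rewrite /Rintegral integral0.
  by apply: eq_Rintegral => phi _; rewrite half_density_sqr indicE
    (negbTE th) !mul0r mulr0.
rewrite Rintegral_mkcond; apply: eq_Rintegral => phi _.
rewrite patchE half_density_sqr !indicE th mul1r.
by case: ifPn => _; rewrite ?mul1r// !mul0r mulr0.
Qed.

Lemma measurable_half_density :
  measurable_fun setT (fun x : R * R => half_density x.1 x.2).
Proof.
apply: measurable_funM; first apply: measurable_funM.
- apply: (measurableT_comp (f := \1_(`[0, pi]%classic : set R) : R -> R)
    (g := fst)) => //; apply: measurable_indic; exact: measurable_itv.
- apply: (measurableT_comp (f := \1_(`[0, 2 * pi]%classic : set R) : R -> R)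
    (g := snd)) => //; apply: measurable_indic; exact: measurable_itv.
- apply: (measurableT_comp (f := Num.sqrt \o sin) (g := fst)) => //.
  apply: continuous_measurable_fun => x.
  by apply: continuous_comp; [exact: continuous_sin | exact: sqrt_continuous].
Qed.

Lemma half_density_sqr_le theta phi : 0 <= half_density theta phi ^+ 2 <=
  \1_(`[0, pi]%classic : set R) theta * \1_(`[0, 2 * pi]%classic : set R) phi.
Proof.
rewrite sqr_ge0 half_density_sqr /= ler_piMr ?sin_le1// mulr_ge0// indicE; lra.
Qed.

End SphereIntegrals.

(** * Three-fold product measures *)

Section TripleProduct.
Context {d1 d2 d3 : measure_display} {T1 : measurableType d1}
  {T2 : measurableType d2} {T3 : measurableType d3} {R : realType}.
Variables (m1 : {sigma_finite_measure set T1 -> \bar R})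
  (m2 : {sigma_finite_measure set T2 -> \bar R})
  (m3 : {sigma_finite_measure set T3 -> \bar R}).

Local Notation m123 := (prod_measure (prod_measure m1 m2) m3).

Lemma prod_measure_tonelli3 (f : T1 * T2 * T3 -> \bar R) :
  measurable_fun setT f -> (forall x, 0 <= f x)%E ->
  (\int[m123]_x f x = \int[m1]_x \int[m2]_y \int[m3]_z f (x, y, z))%E.
Proof.
move=> mf f0; rewrite prod_measure_tonelli// prod_measure_tonelli//.
  exact: measurable_fun_fubini_tonelli_F.
by move=> x; exact: integral_ge0.
Qed.

Lemma prod_measure_fubini3 (f : T1 * T2 * T3 -> R) a : has_int m123 f a ->
  (\int[m1]_x \int[m2]_y \int[m3]_z f (x, y, z))%R = a.
Proof.
move=> fa; have [fi _] := fa; rewrite -(Rintegral_has_int fa).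
have [fi' ->] := prod_measure_fubini fi.
by have [_ ->] := prod_measure_fubini fi'.
Qed.

(** The product measure is bracketed to the left while [g] takes the last two variables together, so
    the factorisation passes through iterated integrals. *)
Lemma has_int_tensor (f : T1 -> R) (g : T2 * T3 -> R) a b :
  has_int m1 f a -> has_int (prod_measure m2 m3) g b ->
  has_int m123 (fun p => f p.1.1 * g (p.1.2, p.2)) (a * b).
Proof.
move=> fa gb; have [fi _] := fa; have [gi _] := gb.
have mf : measurable_fun setT f.
  by apply/measurable_EFinP; exact: measurable_int fi.
have mg : measurable_fun setT g.
  by apply/measurable_EFinP; exact: measurable_int gi.
have mfg : measurable_fun setT
    (fun p : T1 * T2 * T3 => f p.1.1 * g (p.1.2, p.2)).
  have m11 : measurable_fun setT (fun p : T1 * T2 * T3 => p.1.1).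
    exact: (measurableT_comp measurable_fst measurable_fst).
  have m12 : measurable_fun setT (fun p : T1 * T2 * T3 => p.1.2).
    exact: (measurableT_comp measurable_snd measurable_fst).
  apply: measurable_funM; first exact: (measurableT_comp mf m11).
  apply: (measurableT_comp mg); apply/measurable_fun_pairP; split => //.
  exact: measurable_snd.
have fgi : m123.-integrable setT
    (EFin \o (fun p => f p.1.1 * g (p.1.2, p.2))).
  apply/integrableP; split; first exact/measurable_EFinP.
  have mag : measurable_fun setT (fun y => `|(g y)%:E|%E).
    by apply: measurableT_comp => //; exact/measurable_EFinP.
  have [_ gy] := integrableP _ _ _ gi; have [_ fy] := integrableP _ _ _ fi.
  rewrite prod_measure_tonelli3//; last first.
    by apply: measurableT_comp => //; exact/measurable_EFinP.
  have -> : (\int[m1]_x \int[m2]_y \int[m3]_z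
      `|(f x * g (y, z))%:E|)%E =
      (\int[m1]_x (`|(f x)%:E| * \int[prod_measure m2 m3]_y `|(g y)%:E|))%E.
    apply: eq_integral => x _; rewrite -ge0_integralZl// prod_measure_tonelli//.
    - apply: eq_integral => y _; apply: eq_integral => z _.
      by rewrite -abseM.
    - by apply: emeasurable_funM.
  rewrite ge0_integralZr//.
  - by rewrite lte_mul_pinfty// ?integral_ge0// ge0_fin_numE// integral_ge0.
  - by apply: measurableT_comp => //; exact/measurable_EFinP.
  - exact: integral_ge0.
have fgv := has_int_Rintegral fgi.
suff -> : a * b = (\int[m123]_p (f p.1.1 * g (p.1.2, p.2)))%R by exact: fgv.
rewrite -(prod_measure_fubini3 fgv) /=.
(* For each fixed x the inner double integral is f x times that of [g], by Fubini on the last two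
   factors. *)
have gx x : has_int (prod_measure m2 m3) (fun p => f x * g p) (f x * b).
  exact: has_intZ.
under eq_Rintegral => x _.
  have [/prod_measure_fubini[_ h] _] := gx x.
  rewrite -h (Rintegral_has_int (gx x)).
over.
rewrite /= RintegralZr//.
by rewrite (Rintegral_has_int fa).
Qed.

End TripleProduct.

(** * Random fields as functions on Omega times the angles *)

Section SphereRandomFields.
Context {R : realType} {d : measure_display} {Omega : measurableType d}.
Variable P : probability Omega R.
Local Notation mu := (@lebesgue_measure R).
Local Notation M := (prod_measure (prod_measure P mu) mu).
Local Notation hd p := (half_density p.1.2 p.2).

Lemma measurable_angles_uncurry (X : Omega -> R -> R -> R) :
  measurable_angles X ->
  measurable_fun setT (fun p : Omega * R * R => X p.1.1 p.1.2 p.2).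
Proof.
move=> mX; apply: (measurableT_comp (f := fun p => X p.1 p.2.1 p.2.2)
  (g := fun p : Omega * R * R => (p.1.1, (p.1.2, p.2)))) => //.
apply/measurable_fun_pairP; split; first exact:
  (measurableT_comp measurable_fst measurable_fst).
apply/measurable_fun_pairP; split; last exact: measurable_snd.
exact: (measurableT_comp measurable_snd measurable_fst).
Qed.

Lemma measurable_angle_fun (f : R -> R -> R) :
  measurable_fun setT (fun x : R * R => f x.1 x.2) ->
  measurable_fun setT (fun p : Omega * R * R => f p.1.2 p.2).
Proof.
move=> mf; apply: (measurableT_comp (f := fun x : R * R => f x.1 x.2)
  (g := fun p : Omega * R * R => (p.1.2, p.2))) => //.
apply/measurable_fun_pairP; split; last exact: measurable_snd.
exact: (measurableT_comp measurable_snd measurable_fst).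
Qed.

Lemma measurable_random (f : Omega -> R) :
  measurable_fun setT f ->
  measurable_fun setT (fun p : Omega * R * R => f p.1.1).
Proof.
move=> mf; apply: (measurableT_comp mf).
exact: (measurableT_comp measurable_fst measurable_fst).
Qed.

(** An integrand rather than a norm: the squared modulus of X + iY times the surface density. *)
Definition sqnorm (X Y : Omega * R * R -> R) (p : Omega * R * R) : R :=
  (X p * hd p) ^+ 2 + (Y p * hd p) ^+ 2.

Lemma L2normE (X : Omega -> R -> R -> R[i]) (U V : Omega * R * R -> R) :
  (forall w theta phi, X w theta phi = U (w, theta, phi) +i* V (w, theta, phi)) ->
  measurable_fun setT U -> measurable_fun setT V ->
  L2norm P X = sqrte (\int[M]_p (sqnorm U V p)%:E)%E.
Proof.
move=> XE mU mV; rewrite /L2norm; congr sqrte.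
have mhd := measurable_angle_fun (@measurable_half_density R).
rewrite prod_measure_tonelli3.
- apply: eq_integral => w _; rewrite integral_half_density.
  apply: eq_integral => theta _; apply: eq_integral => phi _.
  by rewrite XE /sqnorm /= !exprMn mulrDl.
- apply/measurable_EFinP; apply: measurable_funD; apply: measurable_funX;
    exact: measurable_funM.
- by move=> p; rewrite lee_fin addr_ge0// sqr_ge0.
Qed.

(** Splitting the density evenly between the two factors makes the pairing an inner product on the
    product space. *)
Lemma pairing_has_int (X : Omega -> R -> R -> R) (xi : Omega -> R)
    (f : R * R -> R) v :
  has_int M (fun p => (X p.1.1 p.1.2 p.2 * hd p)
                      * (xi p.1.1 * f (p.1.2, p.2) * hd p)) v ->
  pairing P X xi f = v.
Proof.
move=> /prod_measure_fubini3 <-; apply: eq_Rintegral => w _.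
rewrite Rintegral_half_density.
apply: eq_Rintegral => theta _; apply: eq_Rintegral => phi _ /=.
ring.
Qed.

Lemma bounded_angle_integrable (f : R * R -> R) (c : R) :
  measurable_fun setT f -> (forall x, `|f x| <= c) ->
  exists b, has_int (prod_measure mu mu)
    (fun x => f x * half_density x.1 x.2 ^+ 2) b.
Proof.
move=> mf fc; eexists; apply: has_int_Rintegral.
have mhd2 : measurable_fun setT (fun x : R * R => half_density x.1 x.2 ^+ 2).
  by apply: measurable_funX; exact: measurable_half_density.
have mfh : measurable_fun setT (fun x => f x * half_density x.1 x.2 ^+ 2).
  exact: measurable_funM.
pose D := (`[0, pi]%classic : set R) `*` (`[0, 2 * pi]%classic : set R).
have mD : measurable D by apply: measurableX; exact: measurable_itv.
have iD : (prod_measure mu mu).-integrable setT (EFin \o (fun x => c * \1_D x)).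
  suff i1 : (prod_measure mu mu).-integrable setT (EFin \o \1_D).
    by apply: eq_integrable (integrableZl measurableT c i1) => // x _.
  apply/integrableP; split.
    apply/measurable_EFinP; exact: measurable_indic.
  under eq_integral => x _ do rewrite /= ger0_norm//.
  rewrite integral_indic// setIT [ltLHS]product_measure1E//=.
  rewrite !lebesgue_measure_itv/= !lte_fin pi_gt0 mulr_gt0// ?pi_gt0//.
  by rewrite -!EFinD -EFinM ltry.
apply: le_integrable iD => //; first exact/measurable_EFinP.
move=> x _; rewrite /= lee_fin.
have /andP[h0 h1] := half_density_sqr_le x.1 x.2.
have c0 : 0 <= c := le_trans (normr_ge0 _) (fc x).
rewrite normrM (ger0_norm h0) [leRHS]ger0_norm; last first.
  by rewrite mulr_ge0// indicE.
apply: ler_pM => //; rewrite (le_trans h1)// !indicE.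
have [/set_mem x1|_] := boolP (x.1 \in _); last by rewrite mul0r.
have [/set_mem x2|_] := boolP (x.2 \in _); last by rewrite mulr0.
by rewrite mem_set// mul1r.
Qed.

End SphereRandomFields.

(** * Normalisation of the spherical harmonics *)

Section SphericalHarmonicNorm.
Context {R : realType}.
Local Notation mu := (@lebesgue_measure R).

(** The substitution x = cos theta, carried out through the explicit primitive F; its minus sign
    matches the reversal of orientation. *)
Lemma integral_horner_cos (p : {poly R}) :
  (\int[mu]_(theta in `[0%R, pi%R]) (p.[cos theta] * sin theta)%:E)%E
  = (polyint p)%:E.
Proof.
pose F theta := - (antideriv p).[cos theta].
have dF (x : R) : is_derive x (1 : R) F (p.[cos x] * sin x).
  have h : is_derive x (1 : R) (horner (antideriv p) \o cos)
      ((antideriv p)^`().[cos x] * - sin x).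
    exact: is_derive1_comp.
  have := is_deriveN h; rewrite deriv_antideriv mulrN opprK; exact.
have cF (x : R) : {for x, continuous F}.
  by apply: differentiable_continuous; apply/derivable1_diffP; exact: ex_derive.
rewrite (@continuous_FTC2 _ _ F) ?pi_gt0//.
- by rewrite -EFinD /F cospi cos0 opprK addrC.
- apply: continuous_subspaceT => x.
  apply: (@continuousM R R (horner p \o cos) sin); last exact: continuous_sin.
  by apply: continuous_comp; [exact: continuous_cos | exact: continuous_horner].
- split.
  + by move=> x _; exact: ex_derive.
  + by apply: cvg_at_right_filter; exact: cF.
  + by apply: cvg_at_left_filter; exact: cF.
- by move=> x _; rewrite derive1E; exact: derive_val.
Qed.

Lemma horner_bounded (p : {poly R}) (x : R) :
  `|x| <= 1 -> `|p.[x]| <= \sum_(i < size p) `|p`_i|.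
Proof.
move=> x1; rewrite horner_coef (le_trans (ler_norm_sum _ _ _))//.
apply: ler_sum => i _; rewrite normrM ler_piMr// normrX.
by rewrite exprn_ile1.
Qed.

Lemma norm_cos_le1 (x : R) : `|cos x| <= 1.
Proof. by rewrite ler_norml cos_geN1 cos_le1. Qed.

Lemma norm_sin_le1 (x : R) : `|sin x| <= 1.
Proof. by rewrite ler_norml sin_geN1 sin_le1. Qed.

(** The dependence of Y_lm on phi is a phase, so this real factor is |Y_lm| up to sign. *)
Definition sph_amplitude (l m : nat) (theta : R) : R :=
  Num.sqrt ((2 * l + 1)%N%:R / (4 * pi) * ((l - m)`!%:R / (l + m)`!%:R))
  * assoc_legendre l m (cos theta).

(** The sign in Y_(l,-m) = (-1)^m conj Y_lm. Since [Negz n] is -(n + 1), the exponent is the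
    absolute value of the order. *)
Definition sph_sign (m : int) : R := if m is Negz n then (-1) ^+ n.+1 else 1.

Definition sph_re (l : nat) (m : int) (theta phi : R) : R :=
  sph_sign m * sph_amplitude l `|m|%N theta * cos (`|m|%N%:R * phi).

Definition sph_im (l : nat) (m : int) (theta phi : R) : R :=
  (if m is Negz _ then -1 else 1) * sph_sign m *
  sph_amplitude l `|m|%N theta * sin (`|m|%N%:R * phi).

Lemma sph_harmE (l : nat) (m : int) (theta phi : R) :
  sph_harm l m theta phi = sph_re l m theta phi +i* sph_im l m theta phi.
Proof.
have NC n : (-1) ^+ n = ((-1) ^+ n)%:C :> R[i].
  by rewrite rmorphXn/= rmorphN1.
case: m => n; rewrite /sph_harm ?NC /sph_harm_nat; apply/eqP;
  rewrite eq_complex /= /sph_re /sph_im /sph_sign /sph_amplitude /=; apply/andP;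
    split; apply/eqP; ring.
Qed.

Lemma sph_re_sqr_im_sqr (l : nat) (m : int) (theta phi : R) :
  sph_re l m theta phi ^+ 2 + sph_im l m theta phi ^+ 2
  = sph_amplitude l `|m|%N theta ^+ 2.
Proof.
have s1 : sph_sign m ^+ 2 = 1.
  by case: m => n; rewrite /= ?expr1n// -exprM mulnC exprM sqrrN !expr1n.
rewrite /sph_re /sph_im !exprMn s1.
have -> : (if m is Negz _ then -1 else 1 : R) ^+ 2 = 1.
  by case: m {s1} => n; rewrite ?sqrrN expr1n.
by rewrite !mul1r -mulrDr cos2Dsin2 mulr1.
Qed.

Lemma sph_amplitude_sqr (l m : nat) (theta : R) : sph_amplitude l m theta ^+ 2 =
  (2 * l + 1)%N%:R / (4 * pi) * ((l - m)`!%:R / (l + m)`!%:R)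
  * ((1 - 'X^2) ^+ m * ((legendre l)^`(m)) ^+ 2).[cos theta].
Proof.
rewrite exprMn sqr_sqrtr; last first.
  by rewrite !mulr_ge0 ?invr_ge0 ?mulr_ge0 ?pi_ge0.
have X2E : (1 - 'X^2 : {poly R}).[cos theta] = 1 - cos theta ^+ 2.
  by rewrite !hornerE.
rewrite hornerM !horner_exp X2E /assoc_legendre !exprMn; congr (_ * (_ * _)).
by rewrite -!exprM ![(m * 2)%N]mulnC exprM sqrrN !expr1n mul1r exprM sqr_sqrtr.
Qed.

Lemma continuous_sph_amplitude l m : continuous (sph_amplitude l m).
Proof.
move=> x; apply: (@continuousM R R (cst _) (assoc_legendre l m \o cos));
  first exact: cvg_cst.
apply: continuous_comp; first exact: continuous_cos.
move: (cos x) => y; apply: continuousM; first apply: continuousM.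
- exact: cvg_cst.
- apply: (@continuous_comp _ _ _ (fun z : R => Num.sqrt (1 - z ^+ 2))
    (fun z => z ^+ m)); last exact: exprn_continuous.
  apply: (@continuous_comp _ _ _ (fun z : R => 1 - z ^+ 2) Num.sqrt);
    last exact: sqrt_continuous.
  apply: continuousB; first exact: cvg_cst.
  exact: exprn_continuous.
- exact: continuous_horner.
Qed.

Lemma sph_amplitude_bounded l m : exists c : R, forall theta,
  `|sph_amplitude l m theta| <= c.
Proof.
pose p := (legendre l : {poly R})^`(m).
set k := Num.sqrt ((2 * l + 1)%N%:R / (4 * pi) * ((l - m)`!%:R /
  (l + m)`!%:R)) : R.
exists (k * \sum_(i < size p) `|p`_i|) => theta.
rewrite normrM (ger0_norm (sqrtr_ge0 _)); apply: ler_wpM2l;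
  first exact: sqrtr_ge0.
rewrite !normrM !normrX normrN1 expr1n mul1r (ger0_norm (sqrtr_ge0 _)).
rewrite (le_trans _ (horner_bounded _ (norm_cos_le1 theta)))// ler_piMl//.
rewrite exprn_ile1 ?sqrtr_ge0//.
by rewrite -[leRHS]sqrtr1 ler_wsqrtr// gerBl sqr_ge0.
Qed.

Lemma sph_re_bounded l m : exists c : R, forall x : R * R,
  `|sph_re l m x.1 x.2| <= c.
Proof.
have [c hc] := sph_amplitude_bounded l `|m|%N; exists c => x.
rewrite normrM [`|sph_sign _ * _|]normrM (_ : `|sph_sign m| = 1) ?mul1r.
  by rewrite (le_trans _ (hc x.1))// ler_piMr// norm_cos_le1.
by case: m {hc} => n; rewrite /= ?normrX ?normrN1 ?normr1 ?expr1n.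
Qed.

Lemma sph_im_bounded l m : exists c : R, forall x : R * R,
  `|sph_im l m x.1 x.2| <= c.
Proof.
have [c hc] := sph_amplitude_bounded l `|m|%N; exists c => x.
rewrite normrM [`|_ * sph_amplitude _ _ _|]normrM
  (_ : `|_ * sph_sign m| = 1) ?mul1r.
  by rewrite (le_trans _ (hc x.1))// ler_piMr// norm_sin_le1.
by case: m {hc} => n; rewrite normrM /= ?normrX ?normrN1 ?normr1 ?expr1n mul1r.
Qed.

Lemma measurable_sph_amplitude l m :
  measurable_fun setT (fun x : R * R => sph_amplitude l m x.1).
Proof.
apply: (measurableT_comp (f := sph_amplitude l m) (g := fst)) => //.
by apply: continuous_measurable_fun; exact: continuous_sph_amplitude.
Qed.

Lemma measurable_sph_re l m :
  measurable_fun setT (fun x : R * R => sph_re l m x.1 x.2).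
Proof.
apply: measurable_funM; first apply: measurable_funM => //.
  exact: measurable_sph_amplitude.
apply: (measurableT_comp (f := cos) (g := fun x : R * R => `|m|%N%:R * x.2)).
  by apply: continuous_measurable_fun; exact: continuous_cos.
apply: measurable_funM => //; exact: measurable_snd.
Qed.

Lemma measurable_sph_im l m :
  measurable_fun setT (fun x : R * R => sph_im l m x.1 x.2).
Proof.
apply: measurable_funM; first apply: measurable_funM => //.
  exact: measurable_sph_amplitude.
apply: (measurableT_comp (f := sin) (g := fun x : R * R => `|m|%N%:R * x.2)).
  by apply: continuous_measurable_fun; exact: continuous_sin.
apply: measurable_funM => //; exact: measurable_snd.
Qed.

(** The squared modulus is constant in phi, which contributes 2 pi; the theta-integral is then
    [legendre_sqnorm], and the normalising constant is its inverse up to that factor. *)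
Lemma sph_harm_norm l m : (`|m| <= l)%N ->
  has_int (prod_measure mu mu)
    (fun x => (sph_re l m x.1 x.2 ^+ 2 + sph_im l m x.1 x.2 ^+ 2)
              * half_density x.1 x.2 ^+ 2) 1.
Proof.
move=> ml; have [c hc] := sph_amplitude_bounded l `|m|%N.
have [b hb] : exists b, has_int (prod_measure mu mu)
    (fun x => sph_amplitude l `|m|%N x.1 ^+ 2 * half_density x.1 x.2 ^+ 2) b.
  apply: (@bounded_angle_integrable _ _ (c ^+ 2)).
    by apply: measurable_funX; exact: measurable_sph_amplitude.
  by move=> x; rewrite normrX lerXn2r// nnegrE// (le_trans _ (hc x.1)).
suff b1 : b = 1.
  by rewrite -b1; apply: eq_has_int hb => x; rewrite sph_re_sqr_im_sqr.
apply: EFin_inj; have [bi <-] := hb.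
rewrite prod_measure_tonelli; last 2 first.
- exact: measurable_int bi.
- by move=> x; rewrite lee_fin mulr_ge0 ?sqr_ge0.
rewrite -(integral_half_density
  (fun theta _ => sph_amplitude l `|m|%N theta ^+ 2)).
set k : R := (2 * l + 1)%N%:R / (4 * pi) * ((l - `|m|)`!%:R / (l + `|m|)`!%:R).
set p := (1 - 'X^2) ^+ `|m| * ((legendre l)^`(`|m|)) ^+ 2 : {poly R}.
transitivity (\int[mu]_(theta in `[0%R, pi%R])
    (((2 * pi * k) *: p).[cos theta] * sin theta)%:E)%E.
  apply: eq_integral => theta _; rewrite integral_cst/=;
    last exact: measurable_itv.
  rewrite lebesgue_measure_itv/= lte_fin mulr_gt0 ?pi_gt0// -EFinD -EFinM.
  by rewrite sph_amplitude_sqr hornerZ; congr EFin; rewrite -/k -/p; ring.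
rewrite integral_horner_cos polyintZ [polyint p]legendre_sqnormE//.
congr EFin; rewrite /k.
have pi0 : pi != 0 :> R by rewrite gt_eqF ?pi_gt0.
have f0 n : n`!%:R != 0 :> R by rewrite pnatr_eq0 -lt0n fact_gt0.
have d0 : (2 * l + 1)%:R != 0 :> R by rewrite addn1.
move: pi0 (f0 (l - `|m|)%N) (f0 (l + `|m|)%N) d0.
move: (pi : R) ((l - `|m|)`!%:R : R) ((l + `|m|)`!%:R : R) ((2 * l + 1)%:R : R).
move=> s t u v s0 t0 u0 v0.
by field; rewrite v0 u0 t0 s0.
Qed.

End SphericalHarmonicNorm.

(** * The zonal harmonics as eigenfunctions *)

Section LegendreEigenfunction.
Context {R : realType}.

(** A directional derivative sees only the restriction to a line, so one-variable calculus suffices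
    both on row vectors and on the pair of angles. *)
Lemma is_derive_line (V : normedModType R) (f : V -> R) (x v : V)
    (phi : R -> R) (df : R) :
  (forall h : R, f (h *: v + x) = phi h) -> is_derive (0 : R) (1 : R) phi df ->
  is_derive x v f df.
Proof.
move=> fphi [dphi phiE].
have fx : f x = phi 0 by rewrite -fphi scale0r add0r.
have E : (fun h : R => h^-1 *: ((f \o shift x) (h *: v) - f x)) =
         (fun h : R => h^-1 *: ((phi \o shift 0) (h *: (1 : R)) - phi 0)).
  apply/funext => h /=; by rewrite fphi fx addr0 [h *: 1]mulr1.
by split; rewrite ?/derivable ?/derive E.
Qed.

Lemma is_derive_horner_coord n (p : {poly R}) (i : 'I_n.+1)
  (x v : 'rV[R]_n.+1) :
  is_derive x v (fun y : 'rV[R]_n.+1 => p.[y 0 i]) (v 0 i * p^`().[x 0 i]).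
Proof.
pose q : {poly R} := p \Po ((v 0 i)%:P * 'X + (x 0 i)%:P).
have -> : v 0 i * p^`().[x 0 i] = q^`().[0].
  rewrite deriv_comp hornerM horner_comp derivD derivM derivX !derivC.
  by rewrite mul0r add0r addr0 mulr1 !hornerE mulrC.
apply: (is_derive_line (phi := horner q)) => h.
by rewrite !mxE horner_comp !hornerE mulrC.
Qed.

(** Polynomials in one coordinate are stable under directional derivatives, so one differentiability
    and one continuity argument, applied twice, suffice. *)
Lemma C2_horner_coord n (p : {poly R}) (i : 'I_n.+1) :
  C2 (fun x : 'rV[R]_n.+1 => p.[x 0 i]).
Proof.
have dE (q : {poly R}) (v : 'rV[R]_n.+1) : 'D_v
  (fun x : 'rV[R]_n.+1 => q.[x 0 i]) =
    fun x : 'rV[R]_n.+1 => ((v 0 i) *: q^`()).[x 0 i].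
  apply/funext => x; rewrite (@derive_val _ _ _ _ _ _ _
    (is_derive_horner_coord q i x v)).
  by rewrite hornerZ.
have cont (q : {poly R}) : continuous (fun x : 'rV[R]_n.+1 => q.[x 0 i]).
  move=> x; apply: continuous_comp; first exact: coord_continuous.
  exact: continuous_horner.
move=> v w; split.
- by move=> x; have [] := is_derive_horner_coord p i x v.
- by rewrite dE.
- by rewrite dE => x; have [] := is_derive_horner_coord (v 0 i *: p^`()) i x w.
- by rewrite !dE.
Qed.

(** The factor sin theta comes from the surface measure. It makes the identity true at the poles
    too, where both sides become 0 despite the junk value of [sph_laplacian]. *)
Lemma sph_laplacian_horner_cos (p : {poly R}) (x : R * R) :
  sph_laplacian (fun x : R * R => p.[cos x.1]) x * sin x.1 =
  (((1 - 'X^2) * p^`(2) - 2%:P * 'X * p^`()).[cos x.1]) * sin x.1.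
Proof.
have d1 (F dF : R -> R) : (forall t : R, is_derive t (1 : R) F (dF t)) ->
    'D_(1, 0) (fun x : R * R => F x.1) = fun x => dF x.1.
  move=> h; apply/funext => y.
  suff : is_derive y ((1, 0) : R * R) (fun x : R * R => F x.1) (dF y.1) by case.
  apply: (is_derive_line (phi := fun t => F (t + y.1))) => [t /=|].
    by rewrite -[t *: 1]/(t * 1) mulr1.
  have hs : is_derive (0 : R) (1 : R) (fun t => t + y.1) (1 + 0).
    by apply: is_deriveD.
  have := @is_derive1_comp R F (fun t => t + y.1) 0 (dF (0 + y.1)) (1 + 0)
    (h _) hs.
  by rewrite add0r addr0 mulr1.
have d2 (F : R -> R) : 'D_(0, 1) (fun x : R * R => F x.1) = fun=> 0.
  apply/funext => y.
  suff : is_derive y ((0, 1) : R * R) (fun x : R * R => F x.1) 0 by case.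
  apply: (is_derive_line (phi := fun t => F y.1)) => t /=.
  by rewrite -[t *: 0]/(t * 0) mulr0 add0r.
have dcos (q : {poly R}) (t : R) : is_derive t (1 : R) (fun t => q.[cos t])
  (- sin t * q^`().[cos t]).
  rewrite mulrC.
  have h : is_derive t (1 : R) (horner q \o cos) (q^`().[cos t] * - sin t).
    exact: is_derive1_comp.
  exact: h.
have dcos' (t : R) : is_derive t (1 : R) (fun t => - sin t * p^`().[cos t])
    (- sin t * (- sin t * p^`(2).[cos t]) + p^`().[cos t] * - cos t).
  exact: (@is_deriveM _ _ (fun t => - sin t) _ _ _ _ _ _ (dcos p^`() t)).
have d11 : 'D_(1, 0) ('D_(1, 0) (fun x : R * R => p.[cos x.1])) x =
    - sin x.1 * (- sin x.1 * p^`(2).[cos x.1]) + p^`().[cos x.1] * - cos x.1.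
  by rewrite (d1 _ _ (dcos p)); exact: (congr1 (@^~ x) (d1 _ _ dcos')).
have d1x : 'D_(1, 0) (fun x : R * R => p.[cos x.1]) x
    = - sin x.1 * p^`().[cos x.1].
  exact: (congr1 (@^~ x) (d1 _ _ (dcos p))).
have d22x : 'D_(0, 1) ('D_(0, 1) (fun x : R * R => p.[cos x.1])) x = 0.
  by rewrite (d2 (fun t => p.[cos t])); exact: (congr1 (@^~ x) (d2 (fun=> 0))).
transitivity ((- sin x.1 * (- sin x.1 * p^`(2).[cos x.1])
    + p^`().[cos x.1] * - cos x.1 + (sin x.1 ^+ 2)^-1 * 0
    + cos x.1 / sin x.1 * (- sin x.1 * p^`().[cos x.1])) * sin x.1).
  by congr ((_ + _ * _ + _ * _) * _).
rewrite !hornerE /= -sin2cos2.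
set s := sin x.1; set co := cos x.1; set p1 := p^`().[co]; set p2 := _.[co].
have [->|s0] := eqVneq s 0; first by rewrite !mulr0.
by field.
Qed.

Lemma sph_laplacian_legendre (l : nat) (k : R) (x : R * R) :
  sph_laplacian (fun x : R * R => (k *: legendre l).[cos x.1]) x * sin x.1 =
  - (l%:R * (l%:R + 1)) * ((k *: legendre l).[cos x.1] * sin x.1).
Proof.
rewrite sph_laplacian_horner_cos mulrA; congr (_ * _); rewrite -hornerZ; congr
  (_.[_]).
have := @legendre_ode R l 0; rewrite subr0 addr0 add0r mulr1.
rewrite !derivnS !derivn0 !derivZ => h.
have -> : - (l%:R * (l%:R + 1)) *: (k *: legendre l) =
  - (k *: ((l%:R * (l%:R + 1))%:P * legendre l)) :> {poly R}.
  by rewrite scaleNr mul_polyC !scalerA [_ * k]mulrC.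
rewrite -h -!mul_polyC; ring.
Qed.

End LegendreEigenfunction.

(** * The energy estimate *)

Section DampedEquation.
Context {R : realType}.
Variables (h q : R -> R) (b al k : R).
Hypothesis al_ge0 : 0 <= al.
Hypothesis q_ge0 : forall t : R, 0 < t < b -> 0 <= q t.
Hypothesis dh : forall t : R, 0 < t < b -> derivable h t 1.
Hypothesis ddh : forall t : R, 0 < t < b -> derivable (derive1 h) t 1.
Hypothesis eqh : forall t : R, 0 < t < b ->
  q t * derive1 h t + al * derive1 (derive1 h) t + k * h t = 0.
Hypothesis slope0 : t^-1 * (h t - h 0) @[t --> 0^'+] --> (0 : R).

Let energy t := al * derive1 h t ^+ 2 + k * h t ^+ 2.

Let is_derive_energy t : 0 < t < b ->
  is_derive t (1 : R) energy (- 2 * q t * derive1 h t ^+ 2).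
Proof.
move=> tb; have dht : is_derive t (1 : R) h (derive1 h t).
  by rewrite derive1E; apply: derivableP; exact: dh.
have ddht : is_derive t (1 : R) (derive1 h) (derive1 (derive1 h) t).
  by rewrite [derive1 (derive1 h) t]derive1E; apply: derivableP; exact: ddh.
have := is_deriveD (is_deriveZ al (is_deriveM ddht ddht)) (is_deriveZ k
  (is_deriveM dht dht)).
(* The derivative of the energy is 2 h' (al h'' + k h); subtracting 2 h' times the equation leaves
   -2 q h'^2. *)
have -> : - 2 * q t * derive1 h t ^+ 2 =
    - 2 * derive1 h t * (q t * derive1 h t + al * derive1 (derive1 h) t + k * h t)
    + (al *: (derive1 h t *: derive1 (derive1 h) t + derive1 h t *: derive1
      (derive1 h) t)
       + k *: (h t *: derive1 h t + h t *: derive1 h t)).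
  rewrite /GRing.scale /=; ring.
by rewrite eqh// mulr0 add0r.
Qed.

Let energy_nincr s t : 0 < s -> s <= t -> t < b -> energy t <= energy s.
Proof.
move=> s0 st tb.
have mid x : x \in `[s, t] -> 0 < x < b.
  by rewrite in_itv/= => /andP[sx xt]; rewrite (lt_le_trans s0 sx)
    (le_lt_trans xt tb).
apply: (@ler0_derive1_nincr _ energy s t) => //.
- move=> x /(subset_itv_oo_cc)/mid xb.
  by have [] := is_derive_energy xb.
- move=> x /(subset_itv_oo_cc)/mid xb; have [_ E] := is_derive_energy xb.
  rewrite derive1E E mulNr mulNr oppr_le0 mulr_ge0 ?sqr_ge0//.
  by rewrite mulr_ge0// q_ge0.
- apply: derivable_within_continuous => x /mid xb.
  by have [] := is_derive_energy xb.
Qed.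

Let h_cvg0 : h t @[t --> 0^'+] --> h 0.
Proof.
(* h is recovered from its difference quotient, whose convergence thus gives right continuity at
   0. *)
have : (fun t => t * (t^-1 * (h t - h 0)) + h 0) t @[t --> 0^'+] --> 0 * 0 + h 0.
  apply: cvgD; last exact: cvg_cst.
  by apply: cvgM slope0; apply: cvg_at_right_filter; exact: cvg_id.
rewrite mul0r add0r; apply: cvg_trans; apply: near_eq_cvg; near=> t.
have t0 : t != 0 by rewrite gt_eqF//; near: t; exact: nbhs_right_gt.
by rewrite mulVKf// subrK.
Unshelve. all: by end_near. Qed.

(** By contradiction, with g the excess of k h (t)^2 over k h (0)^2. Near 0 there is a point xi
    where the potential term exceeds k h (0)^2 by less than g / 2 and the kinetic term is below g /
    2. Then energy (xi) < k h (0)^2 + g = k h (t)^2 <= energy (t), against monotonicity. *)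
Lemma damped_energy_bound t : 0 <= t < b -> k * h t ^+ 2 <= k * h 0 ^+ 2.
Proof.
move=> /andP[]; rewrite le_eqVlt => /predU1P[<-//|t0] tb.
rewrite leNgt; apply/negP; rewrite -subr_gt0; set g := _ - _ => g0.
have c1 : k * h s ^+ 2 @[s --> 0^'+] --> k * h 0 ^+ 2.
  exact: (cvgM (cvg_cst k) (cvgM h_cvg0 h_cvg0)).
have c2 : al * (s^-1 * (h s - h 0)) ^+ 2 @[s --> 0^'+] --> (0 : R).
  have := cvgM (cvg_cst al) (cvgM slope0 slope0).
  by rewrite !mulr0; exact.
have near1 : \forall s \near 0^'+, k * h s ^+ 2 < k * h 0 ^+ 2 + g / 2.
  by apply: (cvgr_lt _ c1); rewrite ltrDl divr_gt0.
have near2 : \forall s \near 0^'+, al * (s^-1 * (h s - h 0)) ^+ 2 < g / 2.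
  by apply: (cvgr_lt _ c2); rewrite divr_gt0.
have : nbhs (0 : R) (fun s : R => 0 < s -> k * h s ^+ 2 < k * h 0 ^+ 2 + g / 2 /\
    al * (s^-1 * (h s - h 0)) ^+ 2 < g / 2) by exact: filterI near1 near2.
move=> /nbhs_ballP[e /= e0 he].
(* Half of [e] keeps s strictly inside the ball where both estimates hold, and the minimum keeps it
   at most t. *)
pose s := Num.min t (e / 2).
have s0 : 0 < s by rewrite lt_min t0 divr_gt0.
have st : s <= t by rewrite ge_min lexx.
have sb := le_lt_trans st tb.
have se : s < e by rewrite gt_min; apply/orP; right;
  rewrite gtr_pMr// invf_lt1 ?ltr1n.
have small x : 0 < x -> x <= s -> ball (0 : R) e x.
  move=> x0 xs; rewrite /ball /= sub0r normrN gtr0_norm//.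
  exact: le_lt_trans xs se.
have mid x : 0 < x -> x <= s -> 0 < x < b.
  by move=> x0 xs; rewrite x0 (le_lt_trans xs sb).
(* The mean value theorem converts the small difference quotient at s into a small derivative at
   xi. *)
have [xi] : exists2 xi, xi \in `]0, s[ & h s - h 0 = derive1 h xi * (s - 0).
  apply: MVT => //.
    move=> x; rewrite in_itv/= => /andP[x0 xs]; rewrite derive1E.
    by apply: derivableP; apply: dh; apply: mid => //; exact: ltW.
  apply/continuous_within_itvP => //; split => //.
    move=> x; rewrite in_itv/= => /andP[x0 xs].
    apply: differentiable_continuous; apply/derivable1_diffP; apply: dh.
    by apply: mid => //; exact: ltW.
  apply: cvg_at_left_filter.
  apply: differentiable_continuous; apply/derivable1_diffP; apply: dh.
  exact: mid.
rewrite in_itv/= subr0 => /andP[x0 xs] E.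
have := energy_nincr x0 (le_trans (ltW xs) st) tb.
have [E1 _] := he xi (small _ x0 (ltW xs)) x0.
have [_] := he s (small _ s0 (lexx _)) s0.
rewrite /= in E1 *.
have -> : s^-1 * (h s - h 0) = derive1 h xi by rewrite E mulrC mulfK// gt_eqF.
rewrite /energy => E2 E3.
have : 0 <= al * derive1 h t ^+ 2 by rewrite mulr_ge0// sqr_ge0.
move: E1 E2 E3; rewrite /g; lra.
Qed.

End DampedEquation.

(** * Second moments of the spectral sums *)

Section SpectralSums.
Context {R : realType} {d : measure_display} {Omega : measurableType d}.
Variable P : probability Omega R.
Variables (a : nat -> int -> Omega -> R[i]) (Cl : nat -> R).
Hypothesis a_coefs : spectral_coefs P a Cl.

(** Flattening the double sum over degrees and orders lets norms and pairings be sums over one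
    duplicate-free list; k - l is the order, as in [sph_partial_sum]. *)
Definition modes (m n : nat) : seq (nat * int) :=
  [seq (l, k%:Z - l%:Z) | l <- index_iota m n, k <- iota 0 (2 * l).+1].

Lemma modes_uniq m n : uniq (modes m n).
Proof.
apply: allpairs_uniq_dep; first exact: iota_uniq.
  by move=> l _; exact: iota_uniq.
by move=> [l k] [l' k'] _ _ /= [<- /addIr[<-]].
Qed.

Lemma modesP m n i : reflect (m <= i.1 < n /\ `|i.2| <= i.1)%N (i \in modes m n).
Proof.
apply: (iffP allpairsPdep) => [[l [k [+ + ->]]]|[]].
  by rewrite mem_index_iota mem_iota /= => ->; split => //; lia.
case: i => l k lmn kl; rewrite /= in lmn kl; exists l, (absz (k + l%:Z)%R); split.
- by rewrite mem_index_iota.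
- by rewrite mem_iota /=; lia.
- by congr pair; lia.
Qed.

Lemma sum_modes (V : nmodType) m n (F : nat * int -> V) :
  \sum_(i <- modes m n) F i =
  \sum_(m <= l < n) \sum_(k < (2 * l).+1) F (l, k%:Z - l%:Z).
Proof.
rewrite big_allpairs_dep; apply: eq_bigr => l _.
by rewrite -[iota _ _]/(index_iota 0 (2 * l).+1) big_mkord.
Qed.

Definition mode_re (f : nat -> R) (i : nat * int) (p : Omega * R * R) : R :=
  f i.1 * (complex.Re (a i.1 i.2 p.1.1) * sph_re i.1 i.2 p.1.2 p.2
           - complex.Im (a i.1 i.2 p.1.1) * sph_im i.1 i.2 p.1.2 p.2).

Definition mode_im (f : nat -> R) (i : nat * int) (p : Omega * R * R) : R :=
  f i.1 * (complex.Re (a i.1 i.2 p.1.1) * sph_im i.1 i.2 p.1.2 p.2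
           + complex.Im (a i.1 i.2 p.1.1) * sph_re i.1 i.2 p.1.2 p.2).

Lemma sph_partial_sumE f L w theta phi :
  sph_partial_sum f (fun l m => a l m w) L theta phi =
  (\sum_(i <- modes 0 L.+1) mode_re f i (w, theta, phi))
  +i* (\sum_(i <- modes 0 L.+1) mode_im f i (w, theta, phi)).
Proof.
have cplx_sum (s : seq (nat * int)) (U V : nat * int -> R) :
    ((\sum_(i <- s) U i) +i* (\sum_(i <- s) V i))%C = \sum_(i <- s)
      (U i +i* V i)%C.
  elim: s => [|i s IHs]; first by rewrite !big_nil.
  by rewrite !big_cons -IHs.
rewrite cplx_sum sum_modes big_mkord; apply: eq_bigr => l _.
rewrite big_distrr; apply: eq_bigr => k _ /=;
  rewrite sph_harmE /mode_re /mode_im /=.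
case: (a l _ w) => x y; apply/eqP; rewrite eq_complex /=.
by apply/andP; split; apply/eqP; ring.
Qed.

Lemma measurable_coef_re l m : (`|m| <= l)%N ->
  measurable_fun setT (fun w => complex.Re (a l m w)).
Proof.
move=> ml; have [+ _ _ _] := a_coefs => /(_ l m ml 1 0)[+ _].
by under eq_fun do rewrite mul1r mul0r addr0.
Qed.

Lemma measurable_coef_im l m : (`|m| <= l)%N ->
  measurable_fun setT (fun w => complex.Im (a l m w)).
Proof.
move=> ml; have [+ _ _ _] := a_coefs => /(_ l m ml 0 1)[+ _].
by under eq_fun do rewrite mul1r mul0r add0r.
Qed.

Lemma has_mean_int (Z : Omega -> R[i]) (z : R[i]) : has_mean P Z z ->
  has_int P (fun w => complex.Re (Z w)) (complex.Re z) /\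
  has_int P (fun w => complex.Im (Z w)) (complex.Im z).
Proof. by move=> [ire iim]; rewrite unlock. Qed.

(** The real and imaginary parts of E a_i conj(a_j), which are the random factors met when products
    of modes are expanded. *)
Lemma coef_cov (i j : nat * int) : (`|i.2| <= i.1)%N -> (`|j.2| <= j.1)%N ->
  has_int P (fun w => complex.Re (a i.1 i.2 w) * complex.Re (a j.1 j.2 w)
                      + complex.Im (a i.1 i.2 w) * complex.Im (a j.1 j.2 w))
    (if i == j then Cl i.1 else 0) /\
  has_int P (fun w => complex.Im (a i.1 i.2 w) * complex.Re (a j.1 j.2 w)
                      - complex.Re (a i.1 i.2 w) * complex.Im (a j.1 j.2 w)) 0.
Proof.
case: i j => [l m] [l' m'] /= ml ml';
  have [_ _ _ /(_ l l' m m' ml ml')] := a_coefs.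
move=> /has_mean_int[]; rewrite -pair_eqE /= => re im; split.
  have -> : (if (l == l') && (m == m') then Cl l else 0) =
      complex.Re (if (l == l') && (m == m') then (Cl l)%:C else 0) by case: ifP.
  by apply: eq_has_int re => w; case: (a l m w) (a l' m' w) => x y [x' y'] /=;
    ring.
have -> : 0 = complex.Im (if (l == l') && (m == m') then (Cl l)%:C else 0).
  by case: ifP.
by apply: eq_has_int im => w; case: (a l m w) (a l' m' w) => x y [x' y'] /=; ring.
Qed.

Lemma spectrum_ge0 l : 0 <= Cl l.
Proof.
have [+ _] := @coef_cov (l, 0%Z) (l, 0%Z) isT isT; rewrite eqxx.
by apply: has_int_ge0 => w; rewrite -!expr2 addr_ge0 ?sqr_ge0.
Qed.

End SpectralSums.

Section SpectralIntegrals.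
Context {R : realType} {d : measure_display} {Omega : measurableType d}.
Variable P : probability Omega R.
Variables (a : nat -> int -> Omega -> R[i]) (Cl : nat -> R).
Hypothesis a_coefs : spectral_coefs P a Cl.
Local Notation mu := (@lebesgue_measure R).
Local Notation M := (prod_measure (prod_measure P mu) mu).
Local Notation hd p := (half_density p.1.2 p.2).
Local Notation Yre i x := (sph_re i.1 i.2 x.1 x.2).
Local Notation Yim i x := (sph_im i.1 i.2 x.1 x.2).

Lemma bounded_angle_mul (B B' : R * R -> R) :
  measurable_fun setT B -> measurable_fun setT B' ->
  (exists c : R, forall x, `|B x| <= c) -> (exists c : R, forall x,
    `|B' x| <= c) ->
  exists b, has_int (prod_measure mu mu)
    (fun x => B x * B' x * half_density x.1 x.2 ^+ 2) b.
Proof.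
move=> mB mB' [c hc] [c' hc']; apply: (@bounded_angle_integrable _ _ (c * c')).
  exact: measurable_funM.
by move=> x; rewrite normrM ler_pM.
Qed.

Lemma sph_mode_products (i j : nat * int) : exists b b' : R,
  has_int (prod_measure mu mu) (fun x => (Yre i x * Yre j x + Yim i x * Yim j x)
    * half_density x.1 x.2 ^+ 2) b /\
  has_int (prod_measure mu mu) (fun x => (Yim i x * Yre j x - Yre i x * Yim j x)
    * half_density x.1 x.2 ^+ 2) b'.
Proof.
have mre k := @measurable_sph_re R k.1 k.2.
have mim k := @measurable_sph_im R k.1 k.2.
have bre k := @sph_re_bounded R k.1 k.2.
have bim k := @sph_im_bounded R k.1 k.2.
have [b1 h1] := bounded_angle_mul (mre i) (mre j) (bre i) (bre j).
have [b2 h2] := bounded_angle_mul (mim i) (mim j) (bim i) (bim j).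
have [b3 h3] := bounded_angle_mul (mim i) (mre j) (bim i) (bre j).
have [b4 h4] := bounded_angle_mul (mre i) (mim j) (bre i) (bim j).
exists (b1 + b2), (b3 - b4); split.
  by apply: eq_has_int (has_intD h1 h2) => x /=; ring.
by apply: eq_has_int (has_intB h3 h4) => x /=; ring.
Qed.

Lemma sum_delta (V : nmodType) (I : eqType) (s : seq I) (i : I) (c : V) :
  uniq s -> \sum_(j <- s) (if i == j then c else 0) = if i \in s then c else 0.
Proof.
move=> us; rewrite -big_mkcond /=; case: ifPn => si.
  rewrite (eq_bigl (pred1 i)) => [|j]; last by rewrite eq_sym.
  by rewrite -big_filter filter_pred1_uniq// big_seq1.
rewrite big_seq_cond big1// => j /andP[js /eqP ij].
by rewrite ij js in si.
Qed.

(** The square expands into terms Re (a_i conj(a_j) Y_i conj(Y_j)). Each equals Re Re - Im Im, a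
    difference of products of a random and an angular integral, and [has_int_tensor] applies. *)
Lemma modes_sqnorm (f : nat -> R) (s : seq (nat * int)) : uniq s ->
  (forall i, i \in s -> `|i.2| <= i.1)%N ->
  has_int M (sqnorm (fun p => \sum_(i <- s) mode_re a f i p)
                    (fun p => \sum_(i <- s) mode_im a f i p))
    (\sum_(i <- s) f i.1 ^+ 2 * Cl i.1).
Proof.
move=> us sP.
have term i j : i \in s -> j \in s -> has_int M
    (fun p => (mode_re a f i p * mode_re a f j p + mode_im a f i p * mode_im a f
      j p)
              * hd p ^+ 2)
    (if i == j then f i.1 ^+ 2 * Cl i.1 else 0).
  move=> si sj; have [cre cim] := coef_cov a_coefs (sP i si) (sP j sj).
  have [b [b' [hb hb']]] := sph_mode_products i j.
  have := has_intZ (f i.1 * f j.1)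
    (has_intB (has_int_tensor cre hb) (has_int_tensor cim hb')).
  rewrite mul0r subr0.
  (* Off the diagonal the covariance 0 annihilates the angular integral [b]; on the diagonal
     [sph_harm_norm] gives b = 1. *)
  have -> : f i.1 * f j.1 * ((if i == j then Cl i.1 else 0) * b)
      = if i == j then f i.1 ^+ 2 * Cl i.1 else 0.
    case: ifPn => [/eqP ij|_]; last by rewrite mul0r mulr0.
    rewrite (_ : b = 1) ?mulr1 -?ij ?expr2//; rewrite -ij in hb.
    apply: (has_int_uniq hb); apply: eq_has_int (sph_harm_norm (sP i si)) => x.
    by rewrite -!expr2.
  by apply: eq_has_int => p; rewrite /mode_re /mode_im /=; ring.
have row i : i \in s -> has_int M
    (fun p => \sum_(j <- s) (mode_re a f i p * mode_re a f j p
       + mode_im a f i p * mode_im a f j p) * hd p ^+ 2)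
    (f i.1 ^+ 2 * Cl i.1).
  move=> si; have := has_int_sum (fun j => @term i j si).
  by rewrite sum_delta// si.
have := has_int_sum row.
apply: eq_has_int => p; rewrite /sqnorm.
set U := \sum_(i <- s) mode_re _ _ _ _; set V := \sum_(i <- s) mode_im _ _ _ _.
transitivity (\sum_(i <- s) (mode_re a f i p * U + mode_im a f i p * V) * hd p
  ^+ 2).
  apply: eq_bigr => i _; rewrite -mulr_suml big_split /=.
  by rewrite !mulr_sumr.
rewrite -mulr_suml big_split /= -!mulr_suml -/U -/V; ring.
Qed.

(** At m = 0 the symmetry of the coefficients reads a_l0 = conj a_l0. *)
Lemma coef_zonal_real l : {ae P, forall w, complex.Im (a l 0 w) = 0}.
Proof.
have [_ + _ _] := a_coefs => /(_ l 0 isT); apply: filterS => w.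
rewrite expr0 mul1r oppr0; case: (a l 0 w) => x y [/eqP].
by rewrite -addr_eq0 -mulr2n mulrn_eq0 => /eqP.
Qed.

Lemma modes_pairing (f : nat -> R) (s : seq (nat * int)) l : uniq s ->
  (forall i, i \in s -> `|i.2| <= i.1)%N -> (l, 0%Z) \in s ->
  has_int M (fun p => ((\sum_(i <- s) mode_re a f i p) * hd p)
      * (complex.Re (a l 0 p.1.1) * sph_re l 0 p.1.2 p.2 * hd p))
    (f l * Cl l).
Proof.
move=> us sP ls.
have mre := @measurable_sph_re R l 0; have bre := @sph_re_bounded R l 0.
have term i : i \in s -> has_int M
    (fun p => mode_re a f i p
              * (complex.Re (a l 0 p.1.1) * sph_re l 0 p.1.2 p.2 * hd p ^+ 2))
    (if (l, 0%Z) == i then f l * Cl l else 0).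
  move=> si; have il := sP i si.
  have [cre cim] := coef_cov a_coefs il (sP (l, 0%Z) ls).
  have mai := measurable_coef_re a_coefs il;
    have mbi := measurable_coef_im a_coefs il.
  have mal := measurable_coef_re a_coefs (sP (l, 0%Z) ls).
  (* Almost surely Im a_l0 = 0, so the covariances against a_l0 reduce to products with its real
     part. *)
  have {}cre : has_int P (fun w => complex.Re (a i.1 i.2 w) * complex.Re
    (a l 0 w))
      (if i == (l, 0%Z) then Cl i.1 else 0).
    apply: ae_has_int cre; first exact: measurable_funM.
    by apply: filterS (coef_zonal_real l) => w /= ->; rewrite mulr0 addr0.
  have {}cim : has_int P (fun w => complex.Im (a i.1 i.2 w) * complex.Re
    (a l 0 w)) 0.
    apply: ae_has_int cim; first exact: measurable_funM.
    by apply: filterS (coef_zonal_real l) => w /= ->; rewrite mulr0 subr0.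
  have [b hb] := bounded_angle_mul (@measurable_sph_re R i.1 i.2) mre
    (@sph_re_bounded R i.1 i.2) bre.
  have [b' hb'] := bounded_angle_mul (@measurable_sph_im R i.1 i.2) mre
    (@sph_im_bounded R i.1 i.2) bre.
  have := has_intZ (f i.1) (has_intB (has_int_tensor cre hb)
    (has_int_tensor cim hb')).
  rewrite mul0r subr0.
  have -> : f i.1 * ((if i == (l, 0%Z) then Cl i.1 else 0) * b)
      = if (l, 0%Z) == i then f l * Cl l else 0.
    rewrite eq_sym; case: ifPn => [/eqP ij|_]; last by rewrite mul0r mulr0.
    rewrite (_ : b = 1) ?mulr1 -?ij//; rewrite -ij in hb.
    apply: (has_int_uniq hb); apply: eq_has_int (@sph_harm_norm R l 0 isT) => x.
    by rewrite /sph_im mul0r sin0 mulr0 expr0n addr0 -expr2.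
  by apply: eq_has_int => p; rewrite /mode_re /=; ring.
have := has_int_sum term; rewrite sum_delta// ls.
apply: eq_has_int => p; rewrite -mulr_suml; ring.
Qed.

End SpectralIntegrals.

Section MeanSquareApproximation.
Context {R : realType} {d : measure_display} {Omega : measurableType d}.
Variable P : probability Omega R.
Variables (a : nat -> int -> Omega -> R[i]) (Cl : nat -> R).
Hypothesis a_coefs : spectral_coefs P a Cl.
Local Notation mu := (@lebesgue_measure R).
Local Notation M := (prod_measure (prod_measure P mu) mu).

Lemma measurable_mode_re f i : (`|i.2| <= i.1)%N ->
  measurable_fun setT (mode_re a f i).
Proof.
move=> il; apply: measurable_funM => //; apply: measurable_funB;
  apply: measurable_funM.
- exact: measurable_random (measurable_coef_re a_coefs il).
- exact: measurable_angle_fun (measurable_sph_re _ _).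
- exact: measurable_random (measurable_coef_im a_coefs il).
- exact: measurable_angle_fun (measurable_sph_im _ _).
Qed.

Lemma measurable_mode_im f i : (`|i.2| <= i.1)%N ->
  measurable_fun setT (mode_im a f i).
Proof.
move=> il; apply: measurable_funM => //; apply: measurable_funD;
  apply: measurable_funM.
- exact: measurable_random (measurable_coef_re a_coefs il).
- exact: measurable_angle_fun (measurable_sph_im _ _).
- exact: measurable_random (measurable_coef_im a_coefs il).
- exact: measurable_angle_fun (measurable_sph_re _ _).
Qed.

Lemma measurable_modes (F : nat * int -> Omega * R * R -> R) m n :
  (forall i, (`|i.2| <= i.1)%N -> measurable_fun setT (F i)) ->
  measurable_fun setT (fun p => \sum_(i <- modes m n) F i p).
Proof.
(* Measurability is known for admissible indices only, so summands off the list are first replaced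
   by 0. *)
move=> mF; under eq_fun do rewrite big_seq.
under eq_fun do rewrite big_mkcond /=.
apply: measurable_sum => i; have [/modesP[_ /mF]|_] := boolP
  (i \in modes m n)=> //.
Qed.

Lemma measurable_sqnorm (U V : Omega * R * R -> R) : measurable_fun setT U ->
  measurable_fun setT V ->
  measurable_fun setT (sqnorm U V).
Proof.
have mhd := @measurable_angle_fun R _ Omega _ (@measurable_half_density R).
by move=> mU mV; apply: measurable_funD; apply: measurable_funX;
  apply: measurable_funM.
Qed.

Lemma sqnorm_ge0 (U V : Omega * R * R -> R) p : 0 <= sqnorm U V p.
Proof. by rewrite addr_ge0// sqr_ge0. Qed.

Definition partial_re (f : nat -> R) N (p : Omega * R * R) :=
  \sum_(i <- modes 0 N.+1) mode_re a f i p.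

Definition partial_im (f : nat -> R) N (p : Omega * R * R) :=
  \sum_(i <- modes 0 N.+1) mode_im a f i p.

Definition residual (X : Omega -> R -> R -> R) f N : Omega * R * R -> R :=
  sqnorm (fun p => X p.1.1 p.1.2 p.2 - partial_re f N p)
         (fun p => - partial_im f N p).

Lemma residualE X f N : measurable_angles X ->
  L2norm P (fun w theta phi => (X w theta phi)%:C
    - sph_partial_sum f (fun l m => a l m w) N theta phi)
  = sqrte (\int[M]_p (residual X f N p)%:E)%E.
Proof.
move=> mX; apply: L2normE => [w theta phi||].
- rewrite sph_partial_sumE /partial_re /partial_im.
  by apply/eqP; rewrite eq_complex /= sub0r !eqxx.
- apply: measurable_funB; first exact: measurable_angles_uncurry.
  by apply: measurable_modes => i; exact: measurable_mode_re.
- apply: measurableT_comp => //.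
  by apply: measurable_modes => i; exact: measurable_mode_im.
Qed.

Lemma measurable_residual X f N : measurable_angles X ->
  measurable_fun setT (residual X f N).
Proof.
move=> mX; apply: measurable_sqnorm.
- apply: measurable_funB; first exact: measurable_angles_uncurry.
  by apply: measurable_modes => i; exact: measurable_mode_re.
- apply: measurableT_comp => //.
  by apply: measurable_modes => i; exact: measurable_mode_im.
Qed.

(** Convergence of the extended-real norms makes one of them finite beyond L, so that the residual
    becomes integrable; smallness below sqrt e turns into e after squaring. *)
Lemma residual_small X f (e : R) (L : nat) : measurable_angles X ->
  L2norm P (fun w theta phi => (X w theta phi)%:C
    - sph_partial_sum f (fun l m => a l m w) N theta phi)
    @[N --> \oo] --> 0%E ->
  0 < e -> exists N A, [/\ (L <= N)%N, has_int M (residual X f N) A & A <= e].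
Proof.
move=> mX X0 e0.
have se0 : 0 < Num.sqrt e by rewrite sqrtr_gt0.
have [N /= [NL Ne]] : exists N, (L <= N)%N /\
    (L2norm P (fun w theta phi => (X w theta phi)%:C
       - sph_partial_sum f (fun l m => a l m w) N theta phi)%R
     < (Num.sqrt e)%:E)%E.
  apply: (@filter_ex _ \oo); apply: filterI; first exact: nbhs_infty_ge.
  apply: (X0 [set x : \bar R | (x < (Num.sqrt e)%:E)%E]).
  apply: open_nbhs_nbhs; split; first exact: open_ereal_lt_ereal.
  by rewrite /= lte_fin.
rewrite residualE// in Ne.
have r0 : (0 <= \int[M]_p (residual X f N p)%:E)%E.
  by apply: integral_ge0 => p _; rewrite lee_fin sqnorm_ge0.
have ry : (\int[M]_p (residual X f N p)%:E < +oo)%E.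
  by move: Ne; case: (integral _ _ _) => //= r _; rewrite ltry.
have [A rA] : exists A, has_int M (residual X f N) A.
  apply: has_int_nonneg => //; first exact: measurable_residual.
  by move=> p; exact: sqnorm_ge0.
exists N, A; split=> //; move: Ne; have [_ ->] := rA.
rewrite /= lte_fin ltr_sqrt// => /ltW //.
Qed.

End MeanSquareApproximation.

(** * Projection on the zonal modes *)

Section ZonalPairing.
Context {R : realType} {d : measure_display} {Omega : measurableType d}.
Variable P : probability Omega R.
Variables (a : nat -> int -> Omega -> R[i]) (Cl : nat -> R).
Hypothesis a_coefs : spectral_coefs P a Cl.
Local Notation mu := (@lebesgue_measure R).
Local Notation M := (prod_measure (prod_measure P mu) mu).
Local Notation hd p := (half_density p.1.2 p.2).

(** Y_l0 as a polynomial in cos theta. The terms l - 0 and l + 0 are kept so that the constant is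
    that of [sph_amplitude] at m = 0. *)
Definition zonal_poly l : {poly R} :=
  Num.sqrt ((2 * l + 1)%N%:R / (4 * pi) * ((l - 0)`!%:R / (l + 0)`!%:R))
  *: legendre l.

Lemma zonal_polyE l theta phi :
  (zonal_poly l).[cos theta] = sph_re l 0 theta phi.
Proof.
by rewrite /sph_re /sph_amplitude /assoc_legendre hornerZ !mul1r mul0r cos0 mulr1.
Qed.

(** Since cos theta is the third coordinate on the sphere, this extends Y_l0 to a C^2 function on
    the whole space. *)
Definition zonal_test l (x : 'rV[R]_3) : R := (zonal_poly l).[x 0 ord_max].

Lemma zonal_test_sph l theta phi :
  zonal_test l (sph theta phi) = (zonal_poly l).[cos theta].
Proof. by rewrite /zonal_test mxE. Qed.

Definition zonal_weight l (p : Omega * R * R) : R :=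
  complex.Re (a l 0 p.1.1) * sph_re l 0 p.1.2 p.2 * hd p.

Lemma zonal_coef_sqr l :
  has_int P (fun w => complex.Re (a l 0 w) ^+ 2) (Cl l).
Proof.
have [+ _] := @coef_cov _ _ _ _ _ _ a_coefs (l, 0%Z) (l, 0%Z) isT isT;
  rewrite eqxx.
apply: ae_has_int.
  by apply: measurable_funX; exact: (measurable_coef_re a_coefs (m := 0)).
apply: filterS (coef_zonal_real a_coefs l) => w /= ->.
by rewrite mulr0 addr0 expr2.
Qed.

Lemma measurable_zonal_weight l : measurable_fun setT (zonal_weight l).
Proof.
apply: measurable_funM; first apply: measurable_funM.
- exact: measurable_random (measurable_coef_re a_coefs (m := 0) isT).
- exact: measurable_angle_fun (measurable_sph_re _ _).
- exact: measurable_angle_fun (@measurable_half_density R).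
Qed.

Lemma zonal_weight_sqr l : has_int M (fun p => zonal_weight l p ^+ 2) (Cl l).
Proof.
have := has_int_tensor (zonal_coef_sqr l) (@sph_harm_norm R l 0 isT).
rewrite mulr1; apply: eq_has_int => p.
rewrite /zonal_weight /sph_im mul0r sin0 mulr0; ring.
Qed.

Definition mean_square (X : Omega -> R -> R -> R) : Prop :=
  measurable_angles X /\
  exists A, has_int M (fun p => (X p.1.1 p.1.2 p.2 * hd p) ^+ 2) A.

Lemma measurable_mean_square X : measurable_angles X ->
  measurable_fun setT (fun p : Omega * R * R => X p.1.1 p.1.2 p.2 * hd p).
Proof.
move=> mX; apply: measurable_funM; first exact: measurable_angles_uncurry.
exact: measurable_angle_fun (@measurable_half_density R).
Qed.

Lemma L2norm_realE X : measurable_angles X ->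
  L2norm P (fun w theta phi => (X w theta phi)%:C) =
  sqrte (\int[M]_p ((X p.1.1 p.1.2 p.2 * hd p) ^+ 2)%:E)%E.
Proof.
move=> mX; rewrite (@L2normE _ _ _ _ _ (fun p => X p.1.1 p.1.2 p.2) (cst 0))//.
  by congr sqrte; apply: eq_integral => p _; rewrite /sqnorm mul0r expr0n addr0.
exact: measurable_angles_uncurry.
Qed.

Lemma L2norm_mean_square X : measurable_angles X ->
  (L2norm P (fun w theta phi => (X w theta phi)%:C) < +oo)%E -> mean_square X.
Proof.
move=> mX; rewrite L2norm_realE// => Xy; split=> //.
apply: has_int_nonneg.
- by apply: measurable_funX; exact: measurable_mean_square.
- by move=> p; exact: sqr_ge0.
- by move: Xy; case: (integral _ _ _) => //= r _; rewrite ltry.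
Qed.

Lemma mean_squareB X Y : mean_square X -> mean_square Y ->
  mean_square (fun w theta phi => X w theta phi - Y w theta phi).
Proof.
move=> [mX [A XA]] [mY [B YB]]; split; first exact: measurable_funB.
have [v XYv _] := @has_int_mul _ _ _ M _ _ _ _ (measurable_mean_square mX)
  (measurable_mean_square mY) XA YB.
exists (A - 2 * v + B).
by apply: eq_has_int (has_intD (has_intB XA (has_intZ 2 XYv)) YB) => p; ring.
Qed.

Lemma mean_square_pairing X l : mean_square X ->
  exists v, has_int M (fun p => X p.1.1 p.1.2 p.2 * hd p * zonal_weight l p) v.
Proof.
move=> [mX [A XA]].
have [v Xv _] := @has_int_mul _ _ _ M _ _ _ _ (measurable_mean_square mX)
  (measurable_zonal_weight l) XA (zonal_weight_sqr l).
by exists v.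
Qed.

(** A partial sum of degree N >= l pairs to exactly f_l C_l. By Cauchy-Schwarz the squared error for
    X is at most the integrated residual times C_l, hence arbitrarily small. *)
Lemma zonal_pairing_lim X f l : mean_square X ->
  L2norm P (fun w theta phi => (X w theta phi)%:C
    - sph_partial_sum f (fun l m => a l m w) N theta phi)
    @[N --> \oo] --> 0%E ->
  has_int M (fun p => X p.1.1 p.1.2 p.2 * hd p * zonal_weight l p) (f l * Cl l).
Proof.
move=> sX X0; have [v Xv] := mean_square_pairing l sX; have [mX _] := sX.
suff <- : v = f l * Cl l by [].
apply/eqP; rewrite -subr_eq0 -sqrf_eq0; apply/eqP/le_anti; rewrite sqr_ge0 andbT.
have C0 := spectrum_ge0 a_coefs l.
apply/ler_addgt0Pr => e e0; rewrite add0r.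
(* The added 1 covers C_l = 0 and still gives e / (C_l + 1) * C_l <= e. *)
have e'0 : 0 < e / (Cl l + 1) by rewrite divr_gt0// ltr_wpDl.
have [N [A [lN rA Ae]]] := residual_small a_coefs l mX X0 e'0.
have modesN i : i \in modes 0 N.+1 -> (`|i.2| <= i.1)%N by move=> /modesP[].
have lmode : (l, 0%Z) \in modes 0 N.+1 by apply/modesP; rewrite /= ltnS lN.
have Uv := modes_pairing a_coefs f (modes_uniq _ _) modesN lmode.
have dv := has_intB Xv Uv.
have mU : measurable_fun setT (partial_re a f N).
  by apply: measurable_modes => i; exact: (measurable_mode_re a_coefs).
have mD : measurable_fun setT
    (fun p => (X p.1.1 p.1.2 p.2 - partial_re a f N p) * hd p).
  apply: measurable_funM; last exact: measurable_angle_fun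
    (@measurable_half_density R).
  by apply: measurable_funB => //; exact: measurable_angles_uncurry.
have [A' DA'] : exists A', has_int M
    (fun p => ((X p.1.1 p.1.2 p.2 - partial_re a f N p) * hd p) ^+ 2) A'.
  apply: has_int_nonneg.
  - exact: measurable_funX.
  - by move=> p; exact: sqr_ge0.
  - have [ri rE] := rA.
    apply: (@le_lt_trans _ _ (\int[M]_p (residual a X f N p)%:E)%E);
      last by rewrite rE ltry.
    apply: ge0_le_integral => //.
    + by move=> p _; rewrite lee_fin sqr_ge0.
    + by apply/measurable_EFinP; exact: measurable_funX.
    + exact: measurable_int ri.
    + by move=> p _; rewrite lee_fin lerDl sqr_ge0.
have A'A : A' <= A.
  rewrite -subr_ge0; apply: has_int_ge0 (has_intB rA DA') => p.
  by rewrite /residual /sqnorm addrC addKr sqr_ge0.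
have [v' Dv' v'le] := @has_int_mul _ _ _ M _ _ _ _ mD
  (measurable_zonal_weight l) DA' (zonal_weight_sqr l).
have <- : v' = v - f l * Cl l.
  apply: (has_int_uniq Dv'); apply: eq_has_int dv => p.
  by rewrite /zonal_weight /partial_re; ring.
apply: (le_trans v'le); apply: (@le_trans _ _ (e / (Cl l + 1) * Cl l)).
  by apply: ler_wpM2r => //; exact: le_trans A'A Ae.
by rewrite mulrAC ler_pdivrMr ?ltr_wpDl// ler_wpM2l ?(ltW e0)// lerDl ler01.
Qed.

End ZonalPairing.

Section ModeBound.
Context {R : realType} {d : measure_display} {Omega : measurableType d}.
Variable P : probability Omega R.
Variables (a : nat -> int -> Omega -> R[i]) (Cl : nat -> R).
Hypothesis a_coefs : spectral_coefs P a Cl.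
Local Notation mu := (@lebesgue_measure R).
Local Notation M := (prod_measure (prod_measure P mu) mu).
Local Notation hd p := (half_density p.1.2 p.2).
Variables (c D r eta_oo : R) (T : 'rV[R]_3 -> Omega -> R)
  (u : R -> Omega -> R -> R -> R).
Hypotheses (c_gt0 : 0 < c) (D_gt0 : 0 < D) (r_gt0 : 0 < r)
  (eta_oo_gt0 : 0 < eta_oo).
Hypothesis T_meas : measurable_angles (fun w theta phi => T (sph theta phi) w).
Hypothesis T_expansion :
  L2norm P (fun w theta phi =>
    (T (sph theta phi) w)%:C
    - sph_partial_sum (fun=> 1) (fun l m => a l m w) L theta phi)
    @[L --> \oo] --> 0%E.
Hypothesis u_ivp : ivp_solution c D r eta_oo P T u.
Hypothesis u_expansion : forall eta : R, 0 <= eta < eta_oo ->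
  L2norm P (fun w theta phi =>
    (u eta w theta phi)%:C - u_trunc c D r eta_oo a L eta w theta phi)
    @[L --> \oo] --> 0%E.

(** [escale] is positive and increasing before [eta_oo], which gives the friction term its sign. *)
Lemma damping_ge0 (eta : R) : 0 < eta < eta_oo ->
  0 <= escale eta_oo eta / D
       + derive1 (escale eta_oo) eta / (c ^+ 2 * escale eta_oo eta).
Proof.
move=> /andP[eta0 etab].
have b0 : 0 < eta_oo - eta by rewrite subr_gt0.
have e0 : 0 < escale eta_oo eta by rewrite divr_gt0.
have dB : is_derive eta (1 : R) (fun t => eta_oo - t)
  (0 - 1) by exact: is_deriveB.
have dV := @is_deriveV R (fun t => eta_oo - t) eta _ _ (lt0r_neq0 b0) dB.
have dE : is_derive eta (1 : R) (escale eta_oo)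
    (eta_oo *: (- (eta_oo - eta) ^- 2 *: (0 - 1))).
  exact: (is_deriveZ eta_oo dV).
have e'0 : 0 < derive1 (escale eta_oo) eta.
  rewrite derive1E (@derive_val _ _ _ _ _ _ _ dE) sub0r /GRing.scale /= mulrN1.
  by rewrite opprK mulr_gt0// invr_gt0 exprn_gt0.
by apply: addr_ge0; apply: divr_ge0;
  do ?[exact: ltW | apply: mulr_ge0 | exact: sqr_ge0].
Qed.

Lemma u_mean_square (eta : R) : 0 <= eta < eta_oo -> mean_square P (u eta).
Proof.
have [mu_ Ly _ _] := u_ivp.
by move=> etab; apply: L2norm_mean_square; [exact: mu_ | exact: Ly].
Qed.

(** u (0) and T differ by a field of norm zero, so by Cauchy-Schwarz they have the same pairing, and
    all coefficients in the expansion of T are 1. *)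
Lemma zonal_initial l :
  has_int M (fun p => u 0 p.1.1 p.1.2 p.2 * hd p * zonal_weight a l p) (Cl l).
Proof.
have b0 : 0 <= (0 : R) < eta_oo by apply/andP.
have su := u_mean_square b0; have [mU _] := su.
have [_ _ _ uT] := u_ivp.
have mB : measurable_angles (fun w theta phi => u 0 w theta phi - T
  (sph theta phi) w).
  exact: measurable_funB.
have sB := @L2norm_mean_square _ _ _ P _ mB.
have {}sB : mean_square P (fun w theta phi => u 0 w theta phi - T
  (sph theta phi) w).
  by apply: sB; rewrite uT.
(* T is square integrable as u (0) - (u (0) - T). *)
have sT : mean_square P (fun w theta phi => T (sph theta phi) w).
  have := mean_squareB su sB; congr mean_square.
  by apply/funext => w; apply/funext => th; apply/funext => ph; rewrite subKr.
have := zonal_pairing_lim a_coefs l sT T_expansion; rewrite mul1r => Tv.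
have [v uv] := mean_square_pairing a_coefs l su.
suff <- : v = Cl l by [].
have [_ [A BA]] := sB.
have A0 : A = 0.
  have A_ge0 : 0 <= A by apply: has_int_ge0 BA => p; exact: sqr_ge0.
  move: uT; rewrite L2norm_realE//; have [_ ->] := BA => -[] /eqP.
  by rewrite sqrtr_eq0 => A_le0; apply/le_anti; rewrite A_le0.
have [w Bw wle] := @has_int_mul _ _ _ M _ _ _ _ (measurable_mean_square mB)
  (measurable_zonal_weight a_coefs l) BA (zonal_weight_sqr a_coefs l).
have w0 : w = 0.
  by apply/eqP; rewrite -sqrf_eq0; apply/eqP/le_anti; rewrite sqr_ge0
    (le_trans wle) ?A0 ?mul0r.
apply/eqP; rewrite -subr_eq0 -w0; apply/eqP.
apply: has_int_uniq (has_intB uv Tv) _; apply: eq_has_int Bw => p; ring.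
Qed.

Lemma mode_bound l (eta : R) : 0 <= eta < eta_oo ->
  F_mode c D r eta_oo l eta ^+ 2 * Cl l <= Cl l.
Proof.
move=> etab; case: l => [|l]; first by rewrite expr1n mul1r.
have C0 := spectrum_ge0 a_coefs l.+1.
have [->|Cn0] := eqVneq (Cl l.+1) 0; first by rewrite mulr0.
set L := l.+1 in C0 Cn0 *.
have Cgt0 : 0 < Cl L by rewrite lt_neqAle eq_sym Cn0.
pose xi w := complex.Re (a L 0 w).
pose f (x : R * R) := zonal_test L (sph x.1 x.2).
pose h t := pairing P (u t) xi f.
have fE x : f x = sph_re L 0 x.1 x.2 by rewrite /f zonal_test_sph
  (@zonal_polyE _ _ _ x.2).
have hE t : 0 <= t < eta_oo -> h t = F_mode c D r eta_oo L t * Cl L.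
  move=> tb; apply: pairing_has_int.
  have := zonal_pairing_lim a_coefs L (u_mean_square tb) (u_expansion tb).
  by apply: eq_has_int => p; rewrite fE.
have h0 : h 0 = Cl L.
  apply: pairing_has_int.
  by have := zonal_initial L; apply: eq_has_int => p; rewrite fE.
pose lam : R := L%:R * (L%:R + 1).
have lam0 : 0 < lam by rewrite mulr_gt0// ?ltr_wpDl// ltr0n.
(* The Laplacian already acts on the test function in [ivp_solution], so the eigenvalue relation
   makes the angular term a multiple of h. *)
have lapE t : 0 <= t < eta_oo -> pairing P (u t) xi
  (sph_laplacian f) = - lam * h t.
  move=> tb; apply: pairing_has_int; rewrite hE//.
  have := zonal_pairing_lim a_coefs L (u_mean_square tb) (u_expansion tb).
  move=> /(has_intZ (- lam)); apply: eq_has_int => p.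
  rewrite /zonal_weight -/(xi _).
  transitivity (u t p.1.1 p.1.2 p.2 * xi p.1.1 *
    (- lam * sph_re L 0 p.1.2 p.2 * hd p ^+ 2)); first by ring.
  transitivity (u t p.1.1 p.1.2 p.2 * xi p.1.1 * (sph_laplacian f (p.1.2,
    p.2) * hd p ^+ 2)); last by ring.
  (* Unfolding the density exposes the factor sin theta carried by [sph_laplacian_legendre]. *)
  congr (_ * _); rewrite half_density_sqr mulrCA [RHS]mulrCA; congr (_ * _).
  have fE' : f = fun x => (zonal_poly L).[cos x.1].
    by apply/funext => x; rewrite /f zonal_test_sph.
  by rewrite fE' (sph_laplacian_legendre L _ (p.1.2, p.2)) -/(zonal_poly L)
    (@zonal_polyE _ _ _ p.2) [RHS]mulrA.
have [_ _ ivp _] := u_ivp.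
have [| | |ode slope] := ivp xi (zonal_test L).
- exact: (measurable_coef_re a_coefs (m := 0)).
- by have [] := zonal_coef_sqr a_coefs L.
- exact: C2_horner_coord.
have c2 : 0 <= (c ^+ 2)^-1 by rewrite invr_ge0 sqr_ge0.
have := @damped_energy_bound R h (fun eta => escale eta_oo eta / D
    + derive1 (escale eta_oo) eta / (c ^+ 2 * escale eta_oo eta))
    eta_oo (c ^+ 2)^-1 ((r ^+ 2)^-1 * lam) c2 damping_ge0
    (fun t tb => let: And3 p _ _ := ode t tb in p)
    (fun t tb => let: And3 _ p _ := ode t tb in p) _ slope eta etab.
rewrite h0 hE// ler_pM2l; last by rewrite mulr_gt0 ?invr_gt0 ?exprn_gt0.
(* The energy bound reads (F C)^2 <= C^2 for C = [Cl L]; one factor C > 0 is then cancelled. *)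
move=> bnd; have {}bnd : F_mode c D r eta_oo L eta ^+ 2 * Cl L * Cl L <= Cl L *
  Cl L.
  rewrite -mulrA -[Cl L * Cl L]expr2 -exprMn; apply: bnd => t tb.
  have [_ _ /eqP] := ode t tb; rewrite lapE; last first.
    by case/andP: tb => /ltW -> ->.
  by move=> /eqP E; rewrite -[RHS]E; ring.
by rewrite -(ler_pM2r Cgt0).
Qed.

End ModeBound.

(** * The truncation error *)

Section TruncationError.
Context {R : realType} {d : measure_display} {Omega : measurableType d}.
Variable P : probability Omega R.
Variables (a : nat -> int -> Omega -> R[i]) (Cl : nat -> R).
Hypothesis a_coefs : spectral_coefs P a Cl.
Local Notation mu := (@lebesgue_measure R).
Local Notation M := (prod_measure (prod_measure P mu) mu).
Local Notation hd p := (half_density p.1.2 p.2).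

(** Young's inequality with weight t; the gap is t^-1 (x - t y)^2 in each component. It replaces the
    triangle inequality at the level of integrands, and the factor 1 + t, close to 1, falls on the
    main term. *)
Lemma sqnorm_convex (U V U' V' : Omega * R * R -> R) (t : R) p : 0 < t ->
  sqnorm (fun p => U p + U' p) (fun p => V p + V' p) p
  <= (1 + t) * sqnorm U' V' p + (1 + t^-1) * sqnorm U V p.
Proof.
move=> t0.
have aux (x y : R) : (x + y) ^+ 2 <= (1 + t) * y ^+ 2 + (1 + t^-1) * x ^+ 2.
  rewrite -subr_ge0.
  have -> : (1 + t) * y ^+ 2 + (1 + t^-1) * x ^+ 2 - (x + y) ^+ 2
      = t^-1 * (x - t * y) ^+ 2.
    by field; rewrite gt_eqF.
  by rewrite mulr_ge0 ?sqr_ge0// invr_ge0 ltW.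
rewrite /sqnorm !mulrDl !mulrDr.
have := aux (U p * hd p) (U' p * hd p); have := aux (V p * hd p) (V' p * hd p).
rewrite /sqnorm; lra.
Qed.

Lemma partial_re_split f L N p : (L <= N)%N ->
  partial_re a f N p = partial_re a f L p
    + \sum_(i <- modes L.+1 N.+1) mode_re a f i p.
Proof. by move=> LN; rewrite /partial_re !sum_modes -big_cat_nat. Qed.

Lemma partial_im_split f L N p : (L <= N)%N ->
  partial_im a f N p = partial_im a f L p
    + \sum_(i <- modes L.+1 N.+1) mode_im a f i p.
Proof. by move=> LN; rewrite /partial_im !sum_modes -big_cat_nat. Qed.

Lemma modes_sqnorm_le f m n : (forall l, f l ^+ 2 * Cl l <= Cl l) ->
  \sum_(i <- modes m n) f i.1 ^+ 2 * Cl i.1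
  <= \sum_(m <= l < n) Cl l * (2 * l + 1)%N%:R.
Proof.
move=> fC; rewrite sum_modes; apply: ler_sum => l _.
rewrite /= sumr_const card_ord -[leLHS]mulr_natr addn1.
exact: ler_wpM2r.
Qed.

(** The error splits as (X - S_N) plus the block of degrees from L + 1 to N, where S_N is the
    partial sum. The block is bounded by the tail, the rest tends to 0. *)
Lemma residual_le X f L : measurable_angles X ->
  (forall l, f l ^+ 2 * Cl l <= Cl l) ->
  L2norm P (fun w theta phi => (X w theta phi)%:C
    - sph_partial_sum f (fun l m => a l m w) N theta phi)
    @[N --> \oo] --> 0%E ->
  (\int[M]_p (residual a X f L p)%:E
   <= \sum_(L.+1 <= l <oo) (Cl l * (2 * l + 1)%N%:R)%:E)%E.
Proof.
move=> mX fC X0; set tail := (\sum_(_ <= l <oo) _)%E.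
have C0 l := spectrum_ge0 a_coefs l.
have term0 l : (0 <= (Cl l * (2 * l + 1)%N%:R)%:E)%E by rewrite lee_fin mulr_ge0.
have tail0 : (0 <= tail)%E by apply: nneseries_ge0.
have partial_tail n : ((\sum_(L.+1 <= l < n) Cl l *
  (2 * l + 1)%N%:R)%:E <= tail)%E.
  rewrite -sumEFin; exact: nneseries_lim_ge.
case tailE : tail tail0 => [tau||//] tau0; last by rewrite leey.
apply/lee_addgt0Pr => e e0; rewrite -EFinD.
rewrite lee_fin in tau0.
(* With residual at most t^2 the bound is tau + t tau + t^2 + t, and t <= 1 makes this at most tau +
   t (tau + 2) <= tau + e. *)
pose t := Num.min 1 (e / (tau + 2)).
have tau2 : 0 < tau + 2 by rewrite ltr_wpDl.
have t0 : 0 < t by rewrite lt_min ltr01 divr_gt0.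
have t1 : t <= 1 by rewrite ge_min lexx.
have te : t * (tau + 2) <= e by rewrite -ler_pdivlMr// ge_min lexx orbT.
have [N [A [LN rA At]]] := residual_small a_coefs L mX X0 (mulr_gt0 t0 t0).
have modesN i : i \in modes L.+1 N.+1 -> (`|i.2| <= i.1)%N by move=> /modesP[].
have rB := modes_sqnorm a_coefs f (modes_uniq _ _) modesN.
have Btau : \sum_(i <- modes L.+1 N.+1) f i.1 ^+ 2 * Cl i.1 <= tau.
  rewrite -lee_fin -tailE; apply: le_trans (partial_tail N.+1).
  by rewrite lee_fin; exact: modes_sqnorm_le.
have rAB := has_intD (has_intZ (1 + t) rB) (has_intZ (1 + t^-1) rA).
have [rABi rABE] := rAB.
apply: (@le_trans _ _ ((1 + t) * tau + (1 + t^-1) * (t * t))%:E); last first.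
  rewrite lee_fin mulrDl !mul1r -addrA lerD2l mulrDl mul1r mulrA mulVf ?gt_eqF//
    mul1r.
  apply: le_trans te; nra.
apply: (@le_trans _ _ ((1 + t) * (\sum_(i <- modes L.+1 N.+1) f i.1 ^+ 2 * Cl i.1)
    + (1 + t^-1) * A)%:E); last first.
  rewrite lee_fin; apply: lerD; apply: ler_wpM2l => //.
    by rewrite addr_ge0// ltW.
  by rewrite addr_ge0// invr_ge0 ltW.
rewrite -rABE; apply: ge0_le_integral => //.
- by move=> p _; rewrite lee_fin sqnorm_ge0.
- by apply/measurable_EFinP; exact: (measurable_residual a_coefs f L mX).
- exact: measurable_int rABi.
move=> p _; rewrite lee_fin.
apply: le_trans (sqnorm_convex (fun p => X p.1.1 p.1.2 p.2 - partial_re a f N p)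
  (fun p => - partial_im a f N p)
    (fun p => \sum_(i <- modes L.+1 N.+1) mode_re a f i p)
  (fun p => \sum_(i <- modes L.+1 N.+1) mode_im a f i p) p t0).
rewrite /residual /sqnorm (partial_re_split f p LN) (partial_im_split f p LN).
by rewrite le_eqVlt; apply/orP; left; apply/eqP; ring.
Qed.

End TruncationError.

Theorem theorem3 (R : realType) (d : measure_display)
    (Omega : measurableType d) (P : probability Omega R)
    (c D r eta_oo : R)
    (T : 'rV[R]_3 -> Omega -> R)
    (a : nat -> int -> Omega -> R[i]) (Cl : nat -> R)
    (u : R -> Omega -> R -> R -> R)
    (c_gt0 : 0 < c) (D_gt0 : 0 < D) (r_gt0 : 0 < r) (eta_oo_gt0 : 0 < eta_oo)
    (T_meas : measurable_angles (fun w theta phi => T (sph theta phi) w))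
    (T_gauss : gaussian_field P T)
    (T_centered : centered_field P T)
    (T_isotropic : isotropic_field P T)
    (a_coefs : spectral_coefs P a Cl)
    (T_expansion :
      L2norm P (fun w theta phi =>
        (T (sph theta phi) w)%:C
        - sph_partial_sum (fun=> 1) (fun l m => a l m w) L theta phi)
        @[L --> \oo] --> 0%E)
    (Cl_summable : cvgn (series (fun l => Cl l * (2 * l + 1)%N%:R)))
    (T_regular :
      {ae P, forall w, C2 (fun x : R * R => T (sph x.1 x.2) w)} \/
      cvgn (series (fun l => Cl l * l%:R ^+ 10 * (2 * l + 1)%N%:R)))
    (u_ivp : ivp_solution c D r eta_oo P T u)
    (u_expansion : forall eta : R, 0 <= eta < eta_oo ->
      L2norm P (fun w theta phi =>
        (u eta w theta phi)%:C - u_trunc c D r eta_oo a L eta w theta phi)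
        @[L --> \oo] --> 0%E) :
  exists2 K : R, 0 < K &
    forall (L : nat) (eta : R), 0 <= eta < eta_oo ->
      (L2norm P (fun w theta phi =>
         ((u eta w theta phi)%:C - u_trunc c D r eta_oo a L eta w theta phi)%R)
       <= K%:E * sqrte (\sum_(L.+1 <= l <oo) (Cl l * (2 * l + 1)%N%:R)%:E))%E.
Proof.
exists 1 => // L eta etab; rewrite mul1e.
have [u_meas _ _ _] := u_ivp; have mX := u_meas eta etab.
have fC l := mode_bound a_coefs c_gt0 D_gt0 r_gt0 eta_oo_gt0 T_meas T_expansion
  u_ivp u_expansion l etab.
rewrite [leLHS](residualE a_coefs _ _ mX) lee_sqrt; last first.
  apply: nneseries_ge0 => l _ _; rewrite lee_fin mulr_ge0//.
  exact: (spectrum_ge0 a_coefs l).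
exact: (residual_le (f := fun l => F_mode c D r eta_oo l eta) a_coefs L mX fC
  (u_expansion eta etab)).
Qed.
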